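(* Let $\mathbb{K}\in\{\mathbb{R},\mathbb{C}\}$, let $S\subseteq\mathbb{K}$ be finite, and let $P\in\mathbb{K}[x_1,\dots,x_n]$ be homogeneous of degree $d$. Consider the following algorithm: pick points $\alpha_1,\dots,\alpha_n\in\mathbb{K}^n$ whose coordinates $\alpha_j^{(i)}$ are chosen uniformly and independently at random from $S$; form the $n\times n$ matrix $M$ whose $(i,j)$ entry is $\frac{\partial P}{\partial x_j}(\alpha_i)$; compute by Gaussian elimination a basis $v_1,\dots,v_{n-t}$ of $\ker M$; add vectors $u_1,\dots,u_t$ to obtain a basis of $\mathbb{K}^n$; let $A$ be the $n\times n$ matrix with columns $u_1,\dots,u_t,v_1,\dots,v_{n-t}$ and $f(x)=P(Ax)$; run on the $t$-variable form $f(x_1,\dots,x_t,0,\dots,0)$ the following test (with a fresh random $t\times t$ matrix $R$ with entries uniform and independent from $S$): set $h(x)=f(Rx)$, compute the slices $T_{\bar1},T_{\bar2},T_{\bar3}$ of $h$, reject if $T_{\bar1}$ is singular, and otherwise accept iff $T_{\bar1}^{-1}T_{\bar2}$ and $T_{\bar1}^{-1}T_{\bar3}$ commute and $T_{\bar1}^{-1}T_{\bar2}$ is diagonalisable over $\mathbb{K}$. Output the answer of this test. Then: (i) if $P$ cannot be written as $\sum_{i=1}^t\alpha_il_i^d$ with $l_1,\dots,l_t$ linearly independent linear forms and all $\alpha_i\neq0$, for any $t\le n$, the algorithm rejects with probability at least $\left(1-\frac{2(d-2)}{|S|}\right)\left(1-\frac{n(d-1)}{|S|}\right)$; (ii) if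 $P$ can be written as $\sum_{i=1}^t\alpha_il_i^d$ with $l_1,\dots,l_t$ linearly independent linear forms and all $\alpha_i\neq0$, the algorithm accepts with probability at least $\left(1-\frac{t(d-1)}{|S|}\right)^2$.
   Context: Slices: for a degree-$d$ form $g$ in $m$ variables with symmetric tensor $(T_{i_1\dots i_d})$ (the unique symmetric tensor with $g=\sum T_{i_1\dots i_d}x_{i_1}\cdots x_{i_d}$), the slice $T_{i_1\dots i_{d-2}}$ is the $m\times m$ matrix with $(i_{d-1},i_d)$ entry $T_{i_1\dots i_d}$, and $T_{\bar k}=T_{k\dots k}$.
   Formalization: Assumes S nonempty, d≥2, 2(d−2)≤|S| in (i) and t(d−1)≤|S| in (ii) (else negative factors make the bounds false); t=0 (P=0) counts as a sum; for t<3, where T̄3 is undefined, R gets 3−t extra random columns and slices are cut to t×t. *)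

(* Defs.v *)
From HB Require Import structures.
From mathcomp Require Import all_boot all_order all_algebra.
From mathcomp Require Import finmap boolp reals complex mpoly.

Set Implicit Arguments.
Unset Strict Implicit.
Unset Printing Implicit Defensive.

Import GRing.Theory Num.Theory.
Local Open Scope ring_scope.

Section Forms.
Variable K : fieldType.

Definition linform n (l : 'rV[K]_n) : {mpoly K[n]} := \sum_(j < n) l 0 j *: 'X_j.

(* The linear forms are the rows of L, so their linear independence is
   row_free L. *)
Definition sum_of_powers (n d t : nat) (P : {mpoly K[n]}) : Prop :=
  exists (c : 'I_t -> K) (L : 'M[K]_(t, n)),
    [/\ forall i, c i != 0, row_free L
      & P = \sum_(i < t) c i *: linform (row i L) ^+ d].

(* The form x |-> g (B x). *)
Definition lin_subst n m (B : 'M[K]_(n, m)) (g : {mpoly K[n]}) : {mpoly K[m]} :=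
  g \mPo [tuple linform (row i B) | i < n].

(* The form f (x_1, ..., x_t, 0, ..., 0) in t variables. *)
Definition restrict_vars n t (f : {mpoly K[n]}) : {mpoly K[t]} :=
  f \mPo [tuple if insub (val i) is Some j then 'X_(j : 'I_t) else 0 | i < n].

(* Exponent vector of the monomial x_{i_1} ... x_{i_d}, s = [:: i_1; ...; i_d]. *)
Definition monom_of m (s : seq 'I_m) : 'X_{1..m} :=
  [multinom count_mem i s | i < m].

(* Symmetric tensor of a form: the coefficient of x_{i_1} ... x_{i_d} is shared
   equally between the distinct rearrangements of (i_1, ..., i_d).
   symtensor_perm, symtensor_sum and symtensor_uniq show that, in
   characteristic 0, it is the unique symmetric tensor T such that
   g = \sum T_{i_1 ... i_d} x_{i_1} ... x_{i_d}. *)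
Definition symtensor m (g : {mpoly K[m]}) (s : seq 'I_m) : K :=
  g@_(monom_of s) / (size (permutations s))%:R.

Definition slice m (g : {mpoly K[m]}) (s : seq 'I_m) : 'M[K]_m :=
  \matrix_(i, j) symtensor g (s ++ [:: i; j]).

Definition slice_bar d m (g : {mpoly K[m]}) (k : 'I_m) : 'M[K]_m :=
  slice g (nseq (d - 2) k).

Definition slices_test t (T1 T2 T3 : 'M[K]_t) : bool :=
  [&& T1 \in unitmx,
      comm_mxb (invmx T1 *m T2) (invmx T1 *m T3)
    & `[< diagonalizable (invmx T1 *m T2) >]].

(* If t >= 3 then maxn t 3 = t, R is a t x t matrix, the truncation to the
   first t rows and columns does nothing, and this is the test on T_{\bar 1},
   T_{\bar 2}, T_{\bar 3} (see form_testE).  If t < 3 the form h = g (R x) with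
   R square would have no slice T_{\bar 3}; R then has 3 - t further columns,
   i.e. T_{\bar k} is evaluated at further points when k > t.  Omitting the
   commutation test instead would be wrong: for t = 2 and d >= 4 almost every
   binary form would be accepted. *)
Definition form_test d t (g : {mpoly K[t]}) (R : 'M[K]_(t, maxn t 3)) : bool :=
  let h := lin_subst R g in
  let w := widen_ord (leq_maxl t 3) in
  let T (k : 'I_3) :=
    mxsub w w (slice_bar d h (widen_ord (leq_maxr t 3) k)) in
  slices_test (T 0) (T 1) (T 2).

(* The (i, j) entry is the partial derivative dP/dx_j at the i-th row of a. *)
Definition gradient_mx n (P : {mpoly K[n]}) (a : 'M[K]_n) : 'M[K]_n :=
  \matrix_(i, j) (P^`M(j)).@[fun k => a i k].

(* The columns of A are a basis u_1, ..., u_t, v_1, ..., v_{n-t} of K^n, where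
   t = \rank M and v_1, ..., v_{n-t} is a basis of ker M. *)
Definition kernel_adapted n (M A : 'M[K]_n) : Prop :=
  A \in unitmx /\
  forall v : 'cV[K]_n,
    M *m v = 0 <->
    exists c : 'I_n -> K, v = \sum_(j < n | (\rank M <= j)%N) c j *: col j A.

(* The answer of the algorithm when it has drawn the points a (as rows) and the
   matrix R, and has chosen the basis A. *)
Definition algorithm d n (P : {mpoly K[n]}) (a A : 'M[K]_n)
    (R : 'M[K]_(\rank (gradient_mx P a), maxn (\rank (gradient_mx P a)) 3))
    : bool :=
  form_test d (restrict_vars (\rank (gradient_mx P a)) (lin_subst A P)) R.

Definition mean (T : finType) (F : T -> rat) : rat :=
  (\sum_(x : T) F x) / #|T|%:R.

(* Probability that the answer is b.  A uniform element of 'M[S]_(p, q) is a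
   matrix with uniform independent entries in S.  choice_A is the rule by which
   the algorithm chooses its basis; the size of R depends on a. *)
Definition answer_prob d n (P : {mpoly K[n]}) (S : {fset K})
    (choice_A : 'M[S]_n -> 'M[K]_n) (b : bool) : rat :=
  mean (fun a : 'M[S]_n =>
    let t := \rank (gradient_mx P (map_mx val a)) in
    mean (fun R : 'M[S]_(t, maxn t 3) =>
      (algorithm d (choice_A a) (map_mx val R) == b)%:R)).

Lemma form_testE d m (g : {mpoly K[m.+3]}) (R : 'M[K]_m.+3) :
  let h := lin_subst R g in
  form_test d g R =
  slices_test (slice_bar d h (inord 0)) (slice_bar d h (inord 1))
              (slice_bar d h (inord 2)).
Proof.
have mxsubE (f : 'I_m.+3 -> 'I_m.+3) (B : 'M[K]_m.+3) :
    (forall i, f i = i) -> mxsub f f B = B.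
  by move=> fE; apply/matrixP=> i j; rewrite mxE !fE.
rewrite /form_test /= !mxsubE; try by move=> i; apply: val_inj.
by congr slices_test; congr slice_bar; apply: val_inj; rewrite /= inordK.
Qed.

Lemma kernel_adapted_gauss n (M : 'M[K]_n) :
  kernel_adapted M (invmx (row_ebase M)).
Proof.
have uU := row_ebase_unit M; have uL := col_ebase_unit M.
split; first by rewrite unitmx_inv.
have pidE (c : 'cV[K]_n) i :
    (pid_mx (\rank M) *m c) i 0 = if (i < \rank M)%N then c i 0 else 0.
  rewrite mxE (bigD1 i) //= big1 ?addr0 => [|j ji]; rewrite !mxE.
    by rewrite eqxx /=; case: ltnP; rewrite (mul1r, mul0r).
  by case: eqP => [/val_inj e|]; rewrite ?mul0r // e eqxx in ji *.
have kerE (v : 'cV[K]_n) :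
    M *m v = 0 <-> forall i : 'I_n, (i < \rank M)%N -> (row_ebase M *m v) i 0 = 0.
  rewrite -{1}(mulmx_ebase M) -!mulmxA; split=> [e i ir | e].
    have {}e : pid_mx (\rank M) *m (row_ebase M *m v) = 0 :> 'cV_n.
      by rewrite -[LHS](mulKmx uL) e mulmx0.
    by have := pidE (row_ebase M *m v) i; rewrite e ir mxE.
  suff -> : pid_mx (\rank M) *m (row_ebase M *m v) = 0 :> 'cV_n by rewrite mulmx0.
  by apply/colP=> i; rewrite pidE; case: ltnP => [/e->|]; rewrite mxE.
move=> v; rewrite kerE; split=> [e | [c ->] i ir].
  exists (fun j => (row_ebase M *m v) j 0).
  apply: (can_inj (mulKmx uU)); apply/colP=> i; rewrite mulmx_sumr summxE.
  rewrite (eq_bigr (fun j => (row_ebase M *m v) j 0 * (i == j)%:R)); last first.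
    by move=> j _; rewrite -scalemxAr colE mulmxA mulmxV // mul1mx !mxE andbT.
  have [ir|ir] := ltnP i (\rank M).
    rewrite e // big1 // => j rj; case: eqP => [ij|]; rewrite ?mulr0 //.
    by rewrite -ij leqNgt ir in rj.
  rewrite (bigD1 i) //= eqxx mulr1 big1 ?addr0 // => j /andP[_ ji].
  by rewrite eq_sym (negbTE ji) mulr0.
rewrite mulmx_sumr summxE big1 // => j rj.
rewrite -scalemxAr colE mulmxA mulmxV // mul1mx !mxE andbT.
by case: eqP => [ij|]; rewrite ?mulr0 // -ij leqNgt ir in rj *.
Qed.

Lemma monom_of_perm m (s s' : seq 'I_m) :
  (monom_of s == monom_of s') = perm_eq s s'.
Proof.
apply/eqP/idP => [/mnmP e | /permP e].
  by apply/allP=> i _ /=; have := e i; rewrite !mnmE => ->.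
by apply/mnmP=> i; rewrite !mnmE e.
Qed.

Lemma symtensor_perm m (g : {mpoly K[m]}) (s s' : seq 'I_m) :
  perm_eq s s' -> symtensor g s = symtensor g s'.
Proof.
move=> e; rewrite /symtensor (eqP (_ : monom_of s == monom_of s')).
  by rewrite (perm_size (perm_permutations e)).
by rewrite monom_of_perm.
Qed.

Lemma prod_monom_of m (s : seq 'I_m) :
  \prod_(i <- s) 'X_i = 'X_[monom_of s] :> {mpoly K[m]}.
Proof.
elim: s => [|j s IH].
  have -> : monom_of [::] = 0%MM :> 'X_{1..m}.
    by apply/mnmP=> i; rewrite !mnmE.
  by rewrite big_nil mpolyX0.
have -> : monom_of (j :: s) = (U_(j) + monom_of s)%MM.
  by apply/mnmP=> i; rewrite mnmDE mnm1E !mnmE.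
by rewrite big_cons IH mpolyXD.
Qed.

Lemma card_perm_tuple d m (u : d.-tuple 'I_m) :
  #|[pred s : d.-tuple 'I_m | perm_eq s u]| = size (permutations u).
Proof.
rewrite cardE -(size_map val); apply: perm_size; apply: uniq_perm.
- by rewrite map_inj_uniq ?enum_uniq //; apply: val_inj.
- exact: permutations_uniq.
move=> s; rewrite mem_permutations; apply/mapP/idP => [[t]|su].
  by rewrite mem_enum => tu ->.
have sz : size s == d by rewrite (perm_size su) size_tuple.
by exists (Tuple sz); rewrite // mem_enum.
Qed.

Lemma monom_of_surj d m (mu : 'X_{1..m}) :
  mdeg mu = d -> exists u : d.-tuple 'I_m, monom_of u = mu.
Proof.
move=> mud; pose u := flatten [seq nseq (mu i) i | i <- enum 'I_m].
have uE : monom_of u = mu.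
  apply/mnmP=> i; rewrite mnmE count_flatten -map_comp sumnE big_map big_enum /=.
  rewrite (bigD1 i) //= count_nseq /= eqxx mul1n big1 ?addn0 // => j ji.
  by rewrite count_nseq /= (negbTE ji).
have sz : size u == d.
  by rewrite size_flatten /shape -map_comp sumnE big_map big_enum -mud mdegE;
     apply/eqP/eq_bigr=> i _ /=; rewrite size_nseq.
by exists (Tuple sz).
Qed.

Lemma tensor_coeff d m (T : d.-tuple 'I_m -> K) (u : d.-tuple 'I_m) :
  (forall s s' : d.-tuple 'I_m, perm_eq s s' -> T s = T s') ->
  (\sum_(s : d.-tuple 'I_m) T s *: \prod_(i <- s) 'X_i)@_(monom_of u)
  = T u *+ size (permutations u).
Proof.
move=> Tsym; rewrite raddf_sum /= -card_perm_tuple -sumr_const.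
rewrite [LHS](bigID (fun s : d.-tuple 'I_m => perm_eq s u)) /=.
rewrite [X in _ + X]big1 ?addr0 => [|s su].
  apply: eq_bigr => s su; rewrite mcoeffZ prod_monom_of mcoeffX.
  by rewrite monom_of_perm su mulr1; apply: Tsym.
by rewrite mcoeffZ prod_monom_of mcoeffX monom_of_perm (negbTE su) mulr0.
Qed.

Lemma size_permutations_neq0 m (s : seq 'I_m) : [pchar K] =i pred0 ->
  (size (permutations s))%:R != 0 :> K.
Proof.
move=> charK; rewrite (pcharf0P _).1 // -lt0n; case E: (permutations s) => [|//].
by have := mem_permutations s s; rewrite E perm_refl.
Qed.

Lemma symtensor_sum d m (g : {mpoly K[m]}) :
  [pchar K] =i pred0 -> g \is d.-homog ->
  g = \sum_(s : d.-tuple 'I_m) symtensor g s *: \prod_(i <- s) 'X_i.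
Proof.
move=> charK gd; apply/mpolyP=> mu; have [mud|mud] := eqVneq (mdeg mu) d.
  have [u <-] := monom_of_surj mud.
  rewrite (@tensor_coeff d m (symtensor g)); last first.
    by move=> s s'; apply: symtensor_perm.
  by rewrite -[RHS]mulr_natr /symtensor divfK // size_permutations_neq0.
rewrite (dhomog_nemf_coeff gd mud) raddf_sum /= big1 // => s _.
rewrite mcoeffZ prod_monom_of mcoeffX; case: eqP => [e|_]; last by rewrite mulr0.
case/eqP: mud; rewrite -e mdegE -[RHS](size_tuple s) -sum1_size.
under eq_bigr do rewrite mnmE -sum1_count big_mkcond /=.
rewrite exchange_big; apply: eq_bigr => i _.
rewrite (bigD1 i) //= eqxx big1 // => j ji.
by rewrite eq_sym (negbTE ji).
Qed.

Lemma symtensor_uniq d m (g : {mpoly K[m]}) (T : d.-tuple 'I_m -> K) :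
    [pchar K] =i pred0 ->
    (forall s s' : d.-tuple 'I_m, perm_eq s s' -> T s = T s') ->
    g = \sum_(s : d.-tuple 'I_m) T s *: \prod_(i <- s) 'X_i ->
  forall s : d.-tuple 'I_m, T s = symtensor g s.
Proof.
move=> charK Tsym gE s; rewrite /symtensor {1}gE tensor_coeff // -[T s *+ _]mulr_natr mulfK //.
exact: size_permutations_neq0.
Qed.

End Forms.

(* Main.v *)
Require Import Defs.
From HB Require Import structures.
From mathcomp Require Import all_boot all_order all_algebra.
From mathcomp Require Import perm.
From mathcomp Require Import finmap boolp reals complex mpoly.

Set Implicit Arguments.
Unset Strict Implicit.
Unset Printing Implicit Defensive.

Import Order.TTheory GRing.Theory Num.Theory.
Local Open Scope ring_scope.

(** Write H(y) for the symmetric matrix of T_g(y, ..., y, -, -), a multiple of the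
    Hessian of the form g.  The slices of h(x) = g(R x) are R^T H(r_k) R with r_k
    the k-th column of R, so for invertible R the test is about the matrices
    A(y) = H(r_1)^-1 H(y) at y = r_2, r_3, whose entries have degree d - 2 in y.

    Rejection.  If some A(y), A(z) do not commute, the Schwartz-Zippel lemma in y
    and then in z bounds acceptance by 2 (d - 2) / |S|.  If they all commute, one
    basis diagonalises A(y) for every y in S^t that passes the test, and the
    off-diagonal entries in that basis are polynomials vanishing at all these y:
    either one of them is nonzero, which bounds acceptance by (d - 2) / |S|, or
    every A(y) is diagonal.  In the latter case a Lagrange reduction of H(r_1)
    within the joint eigenspaces makes all H(y) diagonal by one congruence, so all
    mixed coefficients of g vanish in the new coordinates and g is a combination of
    d-th powers of independent forms.

    Gradients.  With high probability ker M is the space of v with dP/dv = 0: while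
    the rows seen so far have a larger kernel, a new row fails to cut it down with
    probability at most (d - 1) / |S|.  Then P(A x) depends only on its first
    \rank M variables, and the restricted form is a sum of powers iff P is. *)

(** * Averages and the Schwartz-Zippel lemma *)

Section Mean.
Variable T : finType.
Implicit Types F G : T -> rat.

Lemma le_mean F G : (forall x, F x <= G x) -> mean F <= mean G.
Proof. by move=> FG; rewrite ler_wpM2r ?invr_ge0 // ler_sum. Qed.

Lemma eq_mean F G : F =1 G -> mean F = mean G.
Proof. by move=> FG; congr (_ / _); apply: eq_bigr. Qed.

Lemma mean_cst c : (0 < #|T|)%N -> mean (fun _ : T => c) = c.
Proof.
by move=> T0; rewrite /mean sumr_const -[c *+ _]mulr_natr mulfK // pnatr_eq0 -lt0n.
Qed.

(** The condition [0 <= c] serves the empty type, over which division by zero makes the mean 0. *)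
Lemma mean_le_cst F c : 0 <= c -> (forall x, F x <= c) -> mean F <= c.
Proof.
move=> c0 Fc; have [T0|T0] := posnP #|T|; last by rewrite -(mean_cst c T0) le_mean.
by rewrite /mean T0 invr0 mulr0.
Qed.

Lemma meanD F G : mean (fun x => F x + G x) = mean F + mean G.
Proof. by rewrite /mean big_split mulrDl. Qed.

Lemma meanZ c F : mean (fun x => c * F x) = c * mean F.
Proof. by rewrite /mean -mulr_sumr mulrA. Qed.

Lemma mean_sum (I : Type) (r : seq I) (Q : pred I) (F : I -> T -> rat) :
  mean (fun x => \sum_(i <- r | Q i) F i x) = \sum_(i <- r | Q i) mean (F i).
Proof. by rewrite /mean exchange_big /= mulr_suml. Qed.

Lemma mean_ge0 F : (forall x, 0 <= F x) -> 0 <= mean F.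
Proof. by move=> F0; rewrite /mean mulr_ge0 ?invr_ge0 ?sumr_ge0. Qed.

Lemma mean_negb (A : pred T) : (0 < #|T|)%N ->
  mean (fun x => (~~ A x)%:R) = 1 - mean (fun x => (A x)%:R).
Proof.
move=> T0; apply/eqP; rewrite eq_sym subr_eq -meanD -{1}(mean_cst 1 T0).
by apply/eqP/eq_mean => x; case: (A x); rewrite /= ?add0r ?addr0.
Qed.

(* (a, x) |-> (upd a x, get a) is an involution of T * X. *)
Lemma mean_resample (X : finType) (get : T -> X) (upd : T -> X -> T) F :
    (forall a x, get (upd a x) = x) ->
    (forall a x, upd (upd a x) (get a) = a) ->
  mean F = mean (fun a => mean (fun x => F (upd a x))).
Proof.
move=> getK updK; have [T0|T0] := posnP #|T|; first by rewrite /mean T0 invr0 !mulr0.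
have X0 : (0 < #|X|)%N.
  by case/card_gt0P: T0 => a _; apply/card_gt0P; exists (get a).
rewrite /mean -mulr_suml pair_big /=.
rewrite [X in _ = X / _ / _](reindex_inj
  (h := fun ax : T * X => (upd ax.1 ax.2, get ax.1))) /=; last first.
  by apply: (can_inj (g := fun ax : T * X => (upd ax.1 ax.2, get ax.1)));
     case=> a x /=; rewrite updK getK.
under [in RHS]eq_bigr do rewrite updK.
rewrite -(pair_big predT predT (fun a x => F a)) /=.
under [in RHS]eq_bigr do rewrite sumr_const -mulr_natr.
by rewrite -mulr_suml mulfK // pnatr_eq0 -lt0n.
Qed.

Lemma mean_resample_le (X : finType) (get : T -> X) (upd : T -> X -> T) F c :
    (forall a x, get (upd a x) = x) ->
    (forall a x, upd (upd a x) (get a) = a) ->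
    0 <= c -> (forall a, mean (fun x => F (upd a x)) <= c) ->
  mean F <= c.
Proof. by move=> getK updK c0 Fc; rewrite (mean_resample F getK updK) mean_le_cst. Qed.

End Mean.

(** * Replacing one row or column of a matrix *)

Section Resampling.
Variables (X : Type) (m n : nat).
Implicit Types a : 'M[X]_(m, n).

Definition set_col (k : 'I_n) a (x : 'cV[X]_m) : 'M[X]_(m, n) :=
  \matrix_(i, j) if j == k then x i 0 else a i j.

Definition set_row (k : 'I_m) a (x : 'rV[X]_n) : 'M[X]_(m, n) :=
  \matrix_(i, j) if i == k then x 0 j else a i j.

Lemma col_set_col k a x : col k (set_col k a x) = x.
Proof. by apply/colP=> i; rewrite !mxE eqxx. Qed.

Lemma col_set_col_neq k l a x : l != k -> col l (set_col k a x) = col l a.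
Proof. by move=> lk; apply/colP=> i; rewrite !mxE (negbTE lk). Qed.

Lemma set_col_col k a x : set_col k (set_col k a x) (col k a) = a.
Proof. by apply/matrixP=> i j; rewrite !mxE; case: eqP => [->|]. Qed.

Lemma row_set_row k a x : row k (set_row k a x) = x.
Proof. by apply/rowP=> i; rewrite !mxE eqxx. Qed.

Lemma row_set_row_neq k l a x : l != k -> row l (set_row k a x) = row l a.
Proof. by move=> lk; apply/rowP=> i; rewrite !mxE (negbTE lk). Qed.

Lemma set_row_row k a x : set_row k (set_row k a x) (row k a) = a.
Proof. by apply/matrixP=> i j; rewrite !mxE; case: eqP => [->|]. Qed.

End Resampling.

Section SchwartzZippel.
Variables (K : fieldType) (S : {fset K}).

Lemma mean_root_le (p : {poly K}) (k : nat) : p != 0 -> (size p <= k.+1)%N ->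
  mean (fun s : S => (p.[val s] == 0)%:R) <= k%:R / #|` S|%:R.
Proof.
move=> p0 pk; rewrite /mean cardfE ler_wpM2r ?invr_ge0 // -natr_sum ler_nat.
rewrite -big_mkcond sum1_card cardE.
have := @max_poly_roots K p [seq val s | s : S in [pred s : S | p.[val s] == 0]] p0.
rewrite map_inj_uniq ?enum_uniq; last exact: val_inj.
rewrite size_map => szp; rewrite -ltnS (leq_trans (szp _ _)) //.
by apply/allP=> x /mapP[s]; rewrite mem_enum inE => ps ->; apply/rootP/eqP.
Qed.

Theorem schwartz_zippel n (p : {mpoly K[n]}) (D : nat) :
  p != 0 -> (msize p <= D.+1)%N ->
  mean (fun x : 'rV[S]_n => (p.@[fun k => val (x 0 k)] == 0)%:R)
    <= D%:R / #|` S|%:R.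
Proof.
(* Induction on a bound k for the variables occurring in p; the step resamples
   the variable of index k and looks at the leading coefficient in it. *)
suff: forall k, (k <= n)%N -> forall D (p : {mpoly K[n]}), p != 0 ->
    (msize p <= D.+1)%N ->
    (forall m, m \in msupp p -> forall i : 'I_n, (k <= i)%N -> m i = 0%N) ->
    mean (fun x : 'rV[S]_n => (p.@[fun k => val (x 0 k)] == 0)%:R)
      <= D%:R / #|` S|%:R.
  move=> H p0 pD; apply: (H n) => // m _ i; by rewrite leqNgt ltn_ord.
elim=> [_|k IH kn] {}D {}p p0 pD pk.
  have pC : p = (p@_0)%:MP.
    apply/mpolyP=> m; rewrite mcoeffC; have [->|m0] := eqVneq m 0%MM.
      by rewrite mulr1.
    rewrite mulr0; apply/eqP; rewrite mcoeff_eq0.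
    apply: contra_neqN m0 => mp; apply/mnmP=> i; by rewrite mnm0E (pk m mp).
  apply: mean_le_cst => [|x]; first by rewrite divr_ge0.
  rewrite pC mevalC (negbTE (_ : p@_0 != 0)) ?divr_ge0 //.
  by apply: contra_neq p0 => p00; rewrite pC p00 mpolyC0.
pose i := Ordinal kn.
(* [m1] is a monomial of [p] with the highest exponent [J] in variable [i]. *)
have [m1 m1p m1max] :
    exists2 m1, m1 \in msupp p & forall m, m \in msupp p -> (m i <= m1 i)%N.
  have ex : exists j, has (fun m : 'X_{1..n} => m i == j) (msupp p).
    by exists (mlead p i); apply/hasP; exists (mlead p) => //; rewrite mlead_supp.
  have ub j : has (fun m : 'X_{1..n} => m i == j) (msupp p) -> (j <= D)%N.
    case/hasP=> m mp /eqP<-; rewrite -ltnS (leq_trans _ pD) //.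
    rewrite (leq_ltn_trans _ (msize_mdeg_lt mp)) // mdegE.
    by rewrite (bigD1 i) //= leq_addr.
  case: (ex_maxnP ex ub) => j /hasP[m1 m1p /eqP<-] mx; exists m1 => // m mp.
  by apply: mx; apply/hasP; exists m.
set J := m1 i in m1max.
(* [c j v] is the coefficient of the [j]-th power of variable [i] in [p], at the values [v] of the
   other variables. The polynomial [q] represents the leading one, [c J], and has degree at most
   [D - J]. *)
pose c j (v : 'I_n -> K) : K :=
  \sum_(m <- msupp p | m i == j) p@_m * \prod_(l < n | l != i) v l ^+ m l.
pose q := \sum_(m <- msupp p | m i == J) p@_m *: 'X_[m - U_(i) *+ J].
have mE := (@mnmBE n, @mnmDE n, @mulmnE n, @mnm1E n).
have qE v : q.@[v] = c J v.
  rewrite /q raddf_sum /=; apply: eq_bigr => m /eqP mJ.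
  rewrite mevalZ mevalX (bigD1 i) //= !mE eqxx mul1n mJ subnn expr0 mul1r.
  congr (_ * _); apply: eq_bigr => l li.
  by rewrite !mE eq_sym (negbTE li) mul0n subn0.
have updE (v w : 'I_n -> K) : (forall l, l != i -> w l = v l) ->
    p.@[w] = (\poly_(j < J.+1) c j v).[w i].
  move=> wv; rewrite horner_poly mevalE /c.
  under [RHS]eq_bigr do rewrite mulr_suml big_mkcond.
  rewrite exchange_big /= big_seq [RHS]big_seq; apply: eq_bigr => m mp.
  have mJ : (m i < J.+1)%N by rewrite ltnS m1max.
  rewrite [RHS](bigD1 (Ordinal mJ)) //= eqxx [X in _ = _ + X]big1 ?addr0.
    rewrite (bigD1 i) //= -[RHS]mulrA [X in _ = _ * X]mulrC; congr (_ * (_ * _)).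
    by apply: eq_bigr => l li; rewrite wv.
  move=> j /eqP jm; case: eqP => // mj; case: jm; exact: val_inj.
have JD : (J <= D)%N.
  rewrite -ltnS (leq_trans _ pD) // (leq_ltn_trans _ (msize_mdeg_lt m1p)) // mdegE.
  by rewrite (bigD1 i) //= leq_addr.
(* Dividing by the [J]-th power of variable [i] is injective on the monomials summed in [q], so
   nothing cancels and the term coming from [m1] keeps [q] nonzero. *)
have qcoef m : q@_m = if m i == 0%N then p@_(m + U_(i) *+ J) else 0.
  rewrite /q raddf_sum /=.
  have shiftE (m' : 'X_{1..n}) : m' i = J ->
      (m' - U_(i) *+ J == m)%MM = (m i == 0%N) && (m' == m + U_(i) *+ J)%MM.
    move=> m'J; apply/eqP/andP => [<-|[/eqP mi0 /eqP->]].
      split; first by rewrite !mE eqxx mul1n m'J subnn.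
      apply/eqP/mnmP=> l; rewrite !mE; case: eqP => [<-|_].
        by rewrite mul1n m'J subnn.
      by rewrite mul0n subn0 addn0.
    by apply/mnmP=> l; rewrite !mE addnK.
  case: ifP => mi0; last first.
    by rewrite big1 // => m' /eqP m'J; rewrite mcoeffZ mcoeffX shiftE // mi0 mulr0.
  under eq_bigr => m' /eqP m'J do rewrite mcoeffZ mcoeffX shiftE // mi0 /=.
  have [mp|mp] := boolP ((m + U_(i) *+ J)%MM \in msupp p); last first.
    rewrite (memN_msupp_eq0 mp) big_seq_cond big1 // => m' /andP[m'p _].
    by case: eqP => [e|]; [rewrite -e m'p in mp | rewrite mulr0].
  rewrite -big_filter (bigD1_seq (m + U_(i) *+ J)%MM) ?filter_uniq //=; last first.
    by rewrite mem_filter mp !mE eqxx mul1n (eqP mi0) eqxx.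
  by rewrite eqxx mulr1 big1 ?addr0 // => m' /negbTE->; rewrite mulr0.
have q0 : q != 0.
  apply/eqP=> /mpolyP/(_ (m1 - U_(i) *+ J)%MM)/eqP; rewrite mcoeff0 qcoef.
  rewrite !mE eqxx mul1n subnn /=; set m := (X in p@_X).
  suff -> : m = m1 by rewrite mcoeff_eq0 m1p.
  by apply/mnmP=> l; rewrite !mE; case: eqP => [<-|_]; rewrite ?mul1n ?subnK // mul0n subn0 addn0.
have qsupp m : m \in msupp q -> m i = 0%N /\ (m + U_(i) *+ J)%MM \in msupp p.
  by rewrite !mcoeff_msupp qcoef; case: (eqVneq (m i) 0%N); rewrite ?eqxx.
have qD : (msize q <= (D - J).+1)%N.
  rewrite msizeE; apply/bigmax_leqP_seq => m /qsupp[_ mp] _.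
  rewrite ltnS leq_subRL // -ltnS (leq_trans _ pD) //.
  apply: leq_trans (msize_mdeg_lt mp); rewrite ltnS mdegD mdegMn mdeg1 mul1n.
  by rewrite addnC.
have {}IH := IH (ltnW kn) _ _ q0 qD _.
have {}IH : mean (fun x : 'rV[S]_n => (q.@[fun k => val (x 0 k)] == 0)%:R)
    <= (D - J)%:R / #|` S|%:R.
  apply: IH => m /qsupp[mi0 mp] l; rewrite leq_eqVlt => /predU1P[kl|kl].
    by rewrite -[RHS]mi0; congr (m _); apply: val_inj.
  by have := pk _ mp l kl; rewrite mnmDE => /eqP; rewrite addn_eq0 => /andP[/eqP].
pose upd (x : 'rV[S]_n) (s : S) : 'rV[S]_n := \row_l if l == i then s else x 0 l.
rewrite (mean_resample (X := S) (get := fun x : 'rV[S]_n => x 0 i) (upd := upd)); first last.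
- by move=> a x; apply/rowP=> l; rewrite !mxE; case: eqP => [->|].
- by move=> a x; rewrite !mxE eqxx.
(* The share [(D - J) / |S|] pays for the points where [q] vanishes. At the others [p] is a nonzero
   univariate polynomial of degree at most [J] in the resampled coordinate, which costs
   [J / |S|]. *)
have DE : D%:R / #|` S|%:R = (D - J)%:R / #|` S|%:R + J%:R / #|` S|%:R :> rat.
  by rewrite -mulrDl -natrD subnK.
have [S0|S0] := posnP #|` S|.
  by apply: mean_le_cst => [|x]; rewrite ?divr_ge0 // /mean -cardfE S0 invr0 !mulr0.
have [X0|X0] := posnP #|{: 'rV[S]_n}|; first by rewrite {1}/mean X0 invr0 mulr0 divr_ge0.
rewrite DE -[J%:R / _](mean_cst _ X0); apply: le_trans (lerD IH (lexx _)).
rewrite -meanD; apply: le_mean => x.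
have updv s : (p.@[fun k => val (upd x s 0 k)] =
    (\poly_(j < J.+1) c j (fun k => val (x 0 k))).[val s]).
  rewrite (updE (fun k => val (x 0 k))); first by rewrite mxE eqxx.
  by move=> l li; rewrite mxE (negbTE li).
under eq_mean do rewrite updv.
have [q00|q00] := eqVneq (q.@[fun k => val (x 0 k)]) 0.
  apply: le_trans (_ : 1 <= _); last by rewrite lerDl divr_ge0.
  by apply: mean_le_cst => // s; case: eqP.
rewrite add0r; apply: mean_root_le; last exact: size_poly.
apply: contra_neq q00 => /polyP/(_ J); rewrite coef_poly ltnSn coef0.
by rewrite qE.
Qed.

End SchwartzZippel.

Lemma mean_reindex (T T' : finType) (f : T -> T') (F : T' -> rat) :
  bijective f -> mean (fun x => F (f x)) = mean F.
Proof.
by move=> bf; rewrite /mean (bij_eq_card bf) [in RHS](reindex f) //; apply: onW_bij.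
Qed.

Lemma schwartz_zippel_cV (K : fieldType) (S : {fset K}) n (p : {mpoly K[n]}) (D : nat) :
  p != 0 -> (msize p <= D.+1)%N ->
  mean (fun x : 'cV[S]_n => (p.@[fun k => val (x k 0)] == 0)%:R)
    <= D%:R / #|` S|%:R.
Proof.
move=> p0 pD; apply: le_trans (schwartz_zippel S p0 pD).
rewrite -[leRHS](mean_reindex (f := @trmx S n 1)).
  by apply: le_mean => x; rewrite (@meval_eq _ _ _ (fun k => val (x^T 0 k))) // => k; rewrite mxE.
by exists trmx; apply: trmxK.
Qed.

(** * Rank of a matrix with independent random rows *)

Section RandomRows.
Variables (K : fieldType) (T X : finType) (m n N : nat).
Variables (get : 'I_m -> T -> X) (upd : 'I_m -> T -> X -> T).
Hypothesis get_upd : forall i a x, get i (upd i a x) = x.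
Hypothesis get_upd_neq : forall i j a x, j != i -> get j (upd i a x) = get j a.
Hypothesis upd_get : forall i a x, upd i (upd i a x) (get i a) = a.
Variables (phi : X -> 'rV[K]_n) (W : 'M[K]_(N, n)) (eps : rat).
Hypothesis eps_ge0 : 0 <= eps.
Hypothesis phi_sub : forall x, (phi x <= W)%MS.
Hypothesis phi_spread : forall U : 'M[K]_n, ~~ (W <= U)%MS ->
  mean (fun x => (phi x <= U)%MS%:R) <= eps.

(* Fails only if some row i < \rank W falls into the span of the earlier ones
   while that span is still too small: a union bound over i. *)
Lemma mean_rank_deficient : (\rank W <= m)%N ->
  mean (fun a : T => (\rank (\matrix_(i < m) phi (get i a)) != \rank W)%:R)
    <= (\rank W)%:R * eps.
Proof.
move=> rm.
pose U a k := (\sum_(j < m | (j < k)%N) <<phi (get j a)>>)%MS.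
pose bad i a := (phi (get i a) <= U a i)%MS && ~~ (W <= U a i)%MS.
have badP a : \rank (\matrix_(i < m) phi (get i a)) != \rank W ->
    exists i : 'I_(\rank W), bad (widen_ord rm i) a.
  move=> rkN; apply: contrapT => nobad; case/negP: rkN.
  (* Without a bad row, the span of the first rows gains a dimension at each index below [\rank W],
     unless it already contains [W]. *)
  have Uk k : (k <= \rank W)%N -> (k <= \rank (U a k))%N.
    elim: k => // k IH kr; have km : (k < m)%N by rewrite (leq_trans kr rm).
    have US : (U a k <= U a k.+1)%MS.
      apply/sumsmx_subP => j jk; apply: (sumsmx_sup j) => //.
      exact: ltnW.
    have [WU|WU] := boolP (W <= U a k)%MS.
      by rewrite (leq_trans kr) // (leq_trans (mxrankS WU)) // mxrankS.
    apply: leq_trans (rank_ltmx (A := U a k) _); first by rewrite ltnS IH // ltnW.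
    rewrite ltmxE US; apply/negP => USk; apply: nobad; exists (Ordinal kr).
    rewrite /bad WU andbT (submx_trans _ USk) //.
    by rewrite (sumsmx_sup (widen_ord rm (Ordinal kr))) ?genmxE.
  rewrite eqn_leq; apply/andP; split.
    by apply/mxrankS/row_subP=> i; rewrite rowK.
  apply: leq_trans (Uk _ (leqnn _)) (mxrankS _).
  apply/sumsmx_subP => j _; rewrite genmxE.
  by rewrite -(rowK (fun i => phi (get i a)) j) row_sub.
apply: le_trans (_ : mean (fun a => \sum_(i < \rank W) (bad (widen_ord rm i) a)%:R) <= _).
  apply: le_mean => a; case: eqP => [_|/eqP/badP[i bi]]; first by rewrite sumr_ge0.
  by rewrite (bigD1 i) //= bi lerDl sumr_ge0.
rewrite mean_sum mulr_natl -[\rank W in leRHS]card_ord -sumr_const ler_sum // => i _.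
apply: (mean_resample_le (get := get (widen_ord rm i)) (upd := upd (widen_ord rm i))) => // a.
set k := widen_ord rm i.
(* The span of the earlier rows does not involve row [k], so it stays fixed while that row is
   resampled and [phi_spread] applies to it. *)
have UE x : U (upd k a x) k = U a k.
  apply: eq_bigr => j jk; rewrite get_upd_neq //.
  by apply: contraTneq jk => ->; rewrite ltnn.
rewrite /bad; under eq_mean do rewrite UE get_upd.
case: (boolP (W <= _)%MS) => [_|WU].
  by apply: mean_le_cst => // x; rewrite andbF.
by under eq_mean do rewrite andbT; apply: phi_spread.
Qed.

End RandomRows.

(** A column of the cokernel of [U] that [W] does not kill. Such a [v] turns membership of a random
    vector in [U] into the vanishing of a nonzero polynomial. *)
Lemma submx_separate (K : fieldType) m1 m2 n (W : 'M[K]_(m1, n)) (U : 'M[K]_(m2, n)) :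
  ~~ (W <= U)%MS -> exists2 v : 'cV[K]_n, U *m v = 0 & W *m v != 0.
Proof.
rewrite submxE => /matrix0Pn[i [j Wij]]; exists (col j (cokermx U)).
  by rewrite colE mulmxA mulmx_coker mul0mx.
by apply/matrix0Pn; exists i, 0; rewrite colE mulmxA -colE mxE.
Qed.

(** * Symmetric tensors and linear substitutions *)

Section Tensors.
Variable K : fieldType.
Hypothesis charK : [pchar K] =i pred0.

Lemma sum_tupleS (V : nmodType) (I : finType) d (F : d.+1.-tuple I -> V) :
  \sum_s F s = \sum_i \sum_(s : d.-tuple I) F [tuple of i :: s].
Proof.
rewrite pair_big /= (reindex (fun p : I * d.-tuple I => [tuple of p.1 :: p.2])) //=.
exists (fun s => (thead s, [tuple of behead s])) => [[i s] _|s _] /=.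
  by congr pair; apply: val_inj.
by rewrite [RHS]tuple_eta.
Qed.

Lemma prod_sum_tuple (A : comPzRingType) (I J : finType) d (G : I -> J -> A)
    (u : d.-tuple J) :
  \prod_(j <- u) \sum_i G i j
    = \sum_(s : d.-tuple I) \prod_(k < d) G (tnth s k) (tnth u k).
Proof.
rewrite big_tuple bigA_distr_bigA /= (reindex (@finfun_of_tuple I d)) /=.
  by apply: eq_bigr => s _; apply: eq_bigr => k _; rewrite ffunE.
apply: onW_bij; exists (@tuple_of_finfun _ _).
  exact: finfun_of_tupleK.
exact: tuple_of_finfunK.
Qed.

Lemma prod_tuple_eq (A : comPzRingType) (I : finType) (i : I) (s : seq I) :
  \prod_(x <- s) (x == i)%:R = (s == nseq (size s) i)%:R :> A.
Proof.
elim: s => [|x s IH]; first by rewrite big_nil.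
by rewrite big_cons IH /= eqseq_cons; case: eqP; rewrite ?mul1r ?mul0r.
Qed.

Lemma dhomog_prodX n d (u : d.-tuple 'I_n) :
  (\prod_(i <- u) 'X_i : {mpoly K[n]}) \is d.-homog.
Proof.
suff H (s : seq 'I_n) : (\prod_(i <- s) 'X_i : {mpoly K[n]}) \is (size s).-homog.
  by have := H u; rewrite size_tuple.
elim: s => [|i s IH]; first by rewrite big_nil dhomog1.
by rewrite big_cons [size _]/= -add1n dhomogM // dhomogX /= mdeg1.
Qed.

Lemma lin_substX n m (B : 'M[K]_(n, m)) i : lin_subst B 'X_i = linform (row i B).
Proof. by rewrite /lin_subst comp_mpolyXU -tnth_nth tnth_mktuple. Qed.

Lemma lin_subst_prodX n m (B : 'M[K]_(n, m)) (s : seq 'I_n) :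
  lin_subst B (\prod_(i <- s) 'X_i) = \prod_(i <- s) linform (row i B).
Proof.
rewrite /lin_subst rmorph_prod; apply: eq_bigr => i _; exact: lin_substX.
Qed.

Lemma lin_subst_sum n m (B : 'M[K]_(n, m)) (I : finType) (c : I -> K) F :
  lin_subst B (\sum_i c i *: F i) = \sum_i c i *: lin_subst B (F i).
Proof. by rewrite /lin_subst raddf_sum; apply: eq_bigr => i _; rewrite /= comp_mpolyZ. Qed.

Lemma lin_subst_tensor n m d (B : 'M[K]_(n, m)) (g : {mpoly K[n]}) :
  g \is d.-homog ->
  lin_subst B g = \sum_(u : d.-tuple 'I_m)
    (\sum_(s : d.-tuple 'I_n) symtensor g s * \prod_(k < d) B (tnth s k) (tnth u k))
      *: \prod_(i <- u) 'X_i.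
Proof.
move=> gd; rewrite {1}(symtensor_sum charK gd) lin_subst_sum.
under [RHS]eq_bigr do rewrite scaler_suml.
rewrite exchange_big; apply: eq_bigr => s _ /=; rewrite lin_subst_prodX.
rewrite (eq_bigr (fun i => \sum_j B i j *: 'X_j)); last first.
  by move=> i _; apply: eq_bigr => j _; rewrite mxE.
rewrite (prod_sum_tuple (fun j i => B i j *: 'X_j)) scaler_sumr; apply: eq_bigr => u _.
by rewrite -scalerA scaler_prod big_tuple.
Qed.

Lemma lin_subst_homog n m d (B : 'M[K]_(n, m)) (g : {mpoly K[n]}) :
  g \is d.-homog -> lin_subst B g \is d.-homog.
Proof.
move=> gd; rewrite (lin_subst_tensor B gd).
by apply: rpred_sum => u _; apply: rpredZ; apply: dhomog_prodX.
Qed.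

(** The right-hand side represents [lin_subst B g], and it is symmetric because a permutation of [u]
    can be absorbed into the summation index [s]; the symmetric tensor is unique. *)
Lemma symtensor_lin_subst n m d (B : 'M[K]_(n, m)) (g : {mpoly K[n]}) (u : d.-tuple 'I_m) :
  g \is d.-homog ->
  symtensor (lin_subst B g) u =
    \sum_(s : d.-tuple 'I_n) symtensor g s * \prod_(k < d) B (tnth s k) (tnth u k).
Proof.
move=> gd; apply/esym; move: u; apply: symtensor_uniq => //; last exact: lin_subst_tensor.
move=> u u' /tuple_permP[sg uE].
have {uE}-> : u = [tuple tnth u' (sg i) | i < d] by apply: val_inj.
rewrite (reindex (fun s : d.-tuple 'I_n => [tuple tnth s (sg i) | i < d])) /=; last first.
  exists (fun s : d.-tuple 'I_n => [tuple tnth s ((sg^-1)%g i) | i < d]) => s _;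
    by apply: eq_from_tnth => i; rewrite !tnth_mktuple ?permK ?permKV.
apply: eq_bigr => s _; congr (_ * _).
  by apply: symtensor_perm; apply/tuple_permP; exists sg.
rewrite [RHS](reindex_inj (@perm_inj _ sg)); apply: eq_bigr => k _.
by rewrite !tnth_mktuple.
Qed.

(* The symmetric matrix of T_g(y, ..., y, -, -), that is, up to the factor
   1 / (d (d - 1)), the Hessian of g at y; here d = e + 2. *)
Definition polar_mx e n (g : {mpoly K[n]}) (y : 'cV[K]_n) : 'M[K]_n :=
  \matrix_(p, q) \sum_(u : e.-tuple 'I_n)
    symtensor g [:: p, q & u] * \prod_(k <- u) y k 0.

Lemma polar_mx_sym e n (g : {mpoly K[n]}) y : (polar_mx e g y)^T = polar_mx e g y.
Proof.
apply/matrixP=> p q; rewrite !mxE; apply: eq_bigr => u _; congr (_ * _).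
by apply: symtensor_perm; rewrite (perm_catCA [:: q] [:: p] u).
Qed.

(** Transformation law of a Hessian: the first two tensor indices yield the outer factors [B^T] and
    [B], the other [e] are contracted with [B *m y]. Both sides expand to the same triple sum. *)
Lemma polar_mx_lin_subst e n m (B : 'M[K]_(n, m)) (g : {mpoly K[n]}) y :
  g \is e.+2.-homog ->
  polar_mx e (lin_subst B g) y = B^T *m polar_mx e g (B *m y) *m B.
Proof.
move=> gd; apply/matrixP=> p q; rewrite !mxE.
transitivity (\sum_a \sum_b \sum_(s : e.-tuple 'I_n)
    symtensor g [:: a, b & s] * B a p * B b q * \prod_(i <- s) (B *m y) i 0).
  have E (u : e.-tuple 'I_m) : symtensor (lin_subst B g) [:: p, q & u] =
      \sum_a \sum_b \sum_(s : e.-tuple 'I_n) symtensor g [:: a, b & s]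
        * (B a p * (B b q * \prod_(k < e) B (tnth s k) (tnth u k))).
    rewrite (symtensor_lin_subst B [tuple of [:: p, q & u]] gd) sum_tupleS.
    apply: eq_bigr => a _; rewrite sum_tupleS; apply: eq_bigr => b _.
    apply: eq_bigr => s _; rewrite !big_ord_recl !(tnth_nth a) !(tnth_nth p) /=.
    do 3!congr (_ * _); apply: eq_bigr => k _.
    by rewrite !(tnth_nth a) !(tnth_nth p).
  under eq_bigr => u _ do rewrite E mulr_suml.
  rewrite exchange_big; apply: eq_bigr => a _.
  under eq_bigr => u _ do rewrite mulr_suml.
  rewrite exchange_big; apply: eq_bigr => b _.
  under eq_bigr => u _ do rewrite mulr_suml.
  rewrite exchange_big; apply: eq_bigr => s _ /=.
  rewrite (eq_bigr (fun i => \sum_j B i j * y j 0)); last by move=> i _; rewrite mxE.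
  rewrite (prod_sum_tuple (fun j i => B i j * y j 0)) mulr_sumr; apply: eq_bigr => u _.
  by rewrite big_split /= (big_tuple _ _ u) !mulrA.
rewrite exchange_big; apply: eq_bigr => b _ /=; rewrite !mxE mulr_suml.
apply: eq_bigr => a _; rewrite !mxE mulr_sumr mulr_suml; apply: eq_bigr => s _.
by rewrite mulrAC mulrA [B a p * symtensor _ _]mulrC.
Qed.

(** Contraction with a basis vector keeps only the constant tuple, so slices are polar matrices at
    basis vectors. *)
Lemma slice_bar_polar e n (g : {mpoly K[n]}) k :
  slice_bar e.+2 g k = polar_mx e g (delta_mx k 0).
Proof.
apply/matrixP=> p q; rewrite !mxE subSS subn1 /=.
rewrite (bigD1 [tuple of nseq e k]) //= [X in _ + X]big1 ?addr0 => [|u uk].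
  rewrite big1_seq ?mulr1 => [|l /andP[_ /nseqP[-> _]]]; last by rewrite mxE !eqxx.
  by apply: symtensor_perm; rewrite perm_catC.
rewrite (eq_bigr (fun l => (l == k)%:R)); last by move=> l _; rewrite mxE andbT.
by rewrite -val_eqE /= in uk; rewrite prod_tuple_eq size_tuple (negbTE uk) mulr0.
Qed.

Lemma slice_bar_lin_subst e n m (R : 'M[K]_(n, m)) (g : {mpoly K[n]}) k :
  g \is e.+2.-homog ->
  slice_bar e.+2 (lin_subst R g) k = R^T *m polar_mx e g (col k R) *m R.
Proof. by move=> gd; rewrite slice_bar_polar polar_mx_lin_subst // colE. Qed.

(** A weighted Fermat form; the forms satisfying [sum_of_powers] are its substitutions by a matrix
    with independent rows. *)
Definition diag_form d n (c : 'I_n -> K) : {mpoly K[n]} := \sum_i c i *: 'X_i ^+ d.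

Lemma diag_form_homog d n (c : 'I_n -> K) : diag_form d c \is d.-homog.
Proof.
apply: rpred_sum => i _; apply: rpredZ.
by have := dhomog_prodX [tuple of nseq d i]; rewrite big_nseq -Monoid.iteropE.
Qed.

Lemma lin_subst_diag_form d n m (B : 'M[K]_(n, m)) c :
  lin_subst B (diag_form d c) = \sum_i c i *: linform (row i B) ^+ d.
Proof.
rewrite lin_subst_sum; apply: eq_bigr => i _; congr (_ *: _).
by rewrite /lin_subst rmorphXn /= -/(lin_subst _ _) lin_substX.
Qed.

Lemma symtensor_diag_form d n (c : 'I_n -> K) (s : d.-tuple 'I_n) :
  symtensor (diag_form d c) s = \sum_i c i * \prod_(x <- s) (x == i)%:R.
Proof.
apply/esym; move: s; apply: symtensor_uniq => // [s s' ss'|].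
  by apply: eq_bigr => i _; congr (_ * _); apply: perm_big.
under [RHS]eq_bigr do rewrite scaler_suml.
rewrite exchange_big; apply: eq_bigr => i _ /=.
rewrite (bigD1 [tuple of nseq d i]) //= [X in _ = _ + X]big1 ?addr0 => [|s si].
  by rewrite prod_tuple_eq size_nseq eqxx mulr1 big_nseq -Monoid.iteropE.
by rewrite -val_eqE /= in si; rewrite prod_tuple_eq size_tuple (negbTE si) mulr0 scale0r.
Qed.

Lemma polar_mx_diag_form e n (c : 'I_n -> K) y :
  polar_mx e (diag_form e.+2 c) y = diag_mx (\row_i (c i * y i 0 ^+ e)).
Proof.
apply/matrixP=> p q; rewrite !mxE.
under eq_bigr => u _ do rewrite (symtensor_diag_form c [tuple of [:: p, q & u]]) mulr_suml.
rewrite exchange_big (bigD1 p) //= [X in _ + X]big1 ?addr0 => [|i ip]; last first.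
  by apply: big1 => u _; rewrite big_cons eq_sym (negbTE ip) mul0r mulr0 mul0r.
under eq_bigr => u _ do rewrite !big_cons eqxx mul1r prod_tuple_eq size_tuple.
rewrite (bigD1 [tuple of nseq e p]) //= eqxx mulr1 big_nseq -Monoid.iteropE big1 ?addr0.
  by rewrite eq_sym; case: eqP; rewrite ?mulr1 ?mulr0 ?mul0r.
by move=> u; rewrite -val_eqE /= => /negbTE->; rewrite !mulr0 mul0r.
Qed.

Lemma symtensor_inj d n (f g : {mpoly K[n]}) : f \is d.-homog -> g \is d.-homog ->
  (forall s : d.-tuple 'I_n, symtensor f s = symtensor g s) -> f = g.
Proof.
move=> fd gd fg; rewrite (symtensor_sum charK fd) (symtensor_sum charK gd).
by apply: eq_bigr => s _; rewrite fg.
Qed.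

End Tensors.

Lemma card_mx_gt0 (K : choiceType) (S : {fset K}) m n :
  (0 < #|` S|)%N -> (0 < #|{: 'M[S]_(m, n)}|)%N.
Proof. by move=> S0; rewrite card_mx expn_gt0 -cardfE S0. Qed.

(** * Matrix-valued polynomial functions of bounded degree *)

Section PolynomialMaps.
Variables (K : fieldType) (n : nat).
Implicit Types (D : nat) (F G : 'cV[K]_n -> K).

(** Total degree at most [D], [msize] being the degree plus one. Working with functions lets matrix
    expressions be bounded entry by entry without lifting them to polynomial matrices. *)
Definition polyfun D F : Prop :=
  exists2 p : {mpoly K[n]}, (msize p <= D.+1)%N & forall y, F y = p.@[fun k => y k 0].

Lemma polyfun_ext D F G : F =1 G -> polyfun D F -> polyfun D G.
Proof. by move=> FG [p pD pF]; exists p => // y; rewrite -FG. Qed.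

Lemma polyfun0 D : polyfun D (fun _ => 0).
Proof. by exists 0; [rewrite msize0 | move=> y; rewrite meval0]. Qed.

Lemma polyfunD D F G : polyfun D F -> polyfun D G -> polyfun D (fun y => F y + G y).
Proof.
move=> [p pD pF] [q qD qG]; exists (p + q); last by move=> y; rewrite mevalD pF qG.
by rewrite (leq_trans (msizeD_le _ _)) // geq_max pD.
Qed.

Lemma polyfunZ D c F : polyfun D F -> polyfun D (fun y => c * F y).
Proof.
move=> [p pD pF]; exists (c *: p); last by move=> y; rewrite mevalZ pF.
by rewrite (leq_trans (msizeZ_le _ _)).
Qed.

Lemma polyfun_sum D (I : Type) (r : seq I) (F : I -> 'cV[K]_n -> K) :
  (forall i, polyfun D (F i)) -> polyfun D (fun y => \sum_(i <- r) F i y).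
Proof.
move=> FD; elim: r => [|i r IH].
  by apply: (polyfun_ext _ (polyfun0 D)) => y; rewrite big_nil.
by apply: (polyfun_ext _ (polyfunD (FD i) IH)) => y; rewrite big_cons.
Qed.

Definition polymx D a b (F : 'cV[K]_n -> 'M[K]_(a, b)) : Prop :=
  forall i j, polyfun D (fun y => F y i j).

Lemma polymx_mull D a b c (X : 'M[K]_(a, b)) (F : 'cV[K]_n -> 'M[K]_(b, c)) :
  polymx D F -> polymx D (fun y => X *m F y).
Proof.
move=> FD i j; apply: (polyfun_ext (F := fun y => \sum_k X i k * F y k j)).
  by move=> y; rewrite mxE.
by apply: polyfun_sum => k; apply: polyfunZ.
Qed.

Lemma polymx_mulr D a b c (X : 'M[K]_(b, c)) (F : 'cV[K]_n -> 'M[K]_(a, b)) :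
  polymx D F -> polymx D (fun y => F y *m X).
Proof.
move=> FD i j; apply: (polyfun_ext (F := fun y => \sum_k X k j * F y i k)).
  by move=> y; rewrite mxE; apply: eq_bigr => k _; rewrite mulrC.
by apply: polyfun_sum => k; apply: polyfunZ.
Qed.

Lemma polymxB D a b (F G : 'cV[K]_n -> 'M[K]_(a, b)) :
  polymx D F -> polymx D G -> polymx D (fun y => F y - G y).
Proof.
move=> FD GD i j; apply: (polyfun_ext _ (polyfunD (FD i j) (polyfunZ (-1) (GD i j)))).
by move=> y; rewrite !mxE mulN1r.
Qed.

Lemma polymx_id : polymx 1 (fun y => y).
Proof.
by move=> i j; rewrite [j]ord1; exists 'X_i; [rewrite msizeX mdeg1 | move=> y; rewrite mevalXU].
Qed.

Lemma mean_polyfun0 (S : {fset K}) D F : polyfun D F -> (exists y, F y != 0) ->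
  mean (fun x : 'cV[S]_n => (F (map_mx val x) == 0)%:R) <= D%:R / #|` S|%:R.
Proof.
move=> [p pD pF] [y0 Fy0].
have p0 : p != 0 by apply: contra_neq Fy0; rewrite pF => ->; rewrite meval0.
apply: le_trans (schwartz_zippel_cV S p0 pD); apply: le_mean => x.
by rewrite pF (@meval_eq _ _ _ (fun k => val (x k 0))) // => k; rewrite mxE.
Qed.

Lemma mean_polymx0 (S : {fset K}) D a b (F : 'cV[K]_n -> 'M[K]_(a, b)) :
  polymx D F -> (exists y, F y != 0) ->
  mean (fun x : 'cV[S]_n => (F (map_mx val x) == 0)%:R) <= D%:R / #|` S|%:R.
Proof.
move=> FD [y /matrix0Pn[i [j Fij]]].
apply: le_trans (mean_polyfun0 S (FD i j) _); last by exists y.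
apply: le_mean => x; have [->|_] := eqVneq (F _) 0; last by [].
by rewrite mxE eqxx.
Qed.

(** In characteristic 0 the integers up to [D] give [D + 1] distinct points, on which a nonzero [p]
    would vanish with probability 1, against the Schwartz-Zippel bound [D / (D + 1)]. *)
Lemma mpoly_eval_eq0 (p : {mpoly K[n]}) : [pchar K] =i pred0 ->
  (forall v, p.@[v] = 0) -> p = 0.
Proof.
move=> charK pv; apply/eqP/negPn/negP => p0; pose D := msize p.
pose S := [fset ((val i)%:R : K) | i in 'I_D.+1]%fset.
have natr_inj (i j : nat) : (i <= j)%N -> i%:R = j%:R :> K -> i = j.
  move=> ij /esym/eqP; rewrite -subr_eq0 -natrB // (pcharf0P K).1 // subn_eq0 => ji.
  by apply/eqP; rewrite eqn_leq ij.
have cS : #|` S| = D.+1.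
  rewrite card_imfset /= -?cardE ?card_ord // => i j ij; apply: val_inj.
  by case/orP: (leq_total i j) => /natr_inj H; [apply: H | apply/esym/H].
have := schwartz_zippel S p0 (leqnSn (msize p)).
under eq_mean do rewrite pv eqxx.
rewrite mean_cst ?card_mx_gt0 ?cS // ler_pdivlMr // mul1r ler_nat.
by rewrite ltnn.
Qed.

End PolynomialMaps.

Lemma mpoly_ring_ind (K : fieldType) n (Q : {mpoly K[n]} -> Prop) :
    (forall c, Q c%:MP) -> (forall i, Q 'X_i) ->
    (forall p q, Q p -> Q q -> Q (p + q)) -> (forall p q, Q p -> Q q -> Q (p * q)) ->
  forall p, Q p.
Proof.
move=> QC QX QD QM p; rewrite (mpolyE p); apply: (big_ind Q) => [|//|m _].
  by rewrite -mpolyC0.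
rewrite -mul_mpolyC; apply: (QM _ _ (QC _)); rewrite mpolyXE_id.
apply: (big_ind Q) => [|//|i _]; first by rewrite -mpolyC1.
by elim: (m i) => [|k IH]; [rewrite expr0 -mpolyC1 | rewrite exprS; apply: (QM _ _ (QX i))].
Qed.

(** * Composition and differentiation of linear substitutions *)

Section LinearSubstitution.
Variable K : fieldType.

Lemma lin_substM n m k (A : 'M[K]_(n, m)) (B : 'M[K]_(m, k)) p :
  lin_subst B (lin_subst A p) = lin_subst (A *m B) p.
Proof.
elim/mpoly_ring_ind: p => [c|i|p q IHp IHq|p q IHp IHq].
- by rewrite /lin_subst !comp_mpolyC.
- rewrite !lin_substX /linform lin_subst_sum.
  under eq_bigr do rewrite lin_substX scaler_sumr.
  rewrite exchange_big; apply: eq_bigr => j _; rewrite !mxE scaler_suml.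
  by apply: eq_bigr => l _; rewrite !mxE scalerA.
- by rewrite /lin_subst !rmorphD /= -!/(lin_subst _ _) IHp IHq.
- by rewrite /lin_subst !rmorphM /= -!/(lin_subst _ _) IHp IHq.
Qed.

Lemma lin_subst1 n (p : {mpoly K[n]}) : lin_subst 1%:M p = p.
Proof.
rewrite -[RHS]comp_mpoly_id; congr (_ \mPo _); apply: eq_from_tnth => i.
rewrite !tnth_mktuple /linform (bigD1 i) //= !mxE eqxx scale1r big1 ?addr0 // => j ji.
by rewrite !mxE eq_sym (negbTE ji) scale0r.
Qed.

(** The chain rule; both sides obey the same Leibniz rule, so constants and variables suffice. *)
Lemma mderiv_lin_subst n m (A : 'M[K]_(n, m)) p j :
  (lin_subst A p)^`M(j) = lin_subst A (\sum_i A i j *: p^`M(i)).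
Proof.
rewrite lin_subst_sum.
elim/mpoly_ring_ind: p => [c|i|p q IHp IHq|p q IHp IHq].
- rewrite /lin_subst comp_mpolyC mderivC big1 // => i _.
  by rewrite mderivC comp_mpoly0 scaler0.
- rewrite lin_substX /linform raddf_sum /=.
  transitivity ((A i j)%:MP : {mpoly K[m]}).
    rewrite (bigD1 j) //= big1 ?addr0 => [|k kj].
      rewrite mderivZ mderivX mnm1E eqxx scale1r mxE -mul_mpolyC.
      rewrite (_ : U_(j) - U_(j) = 0)%MM ?mpolyX0 ?mulr1 //.
      by apply/mnmP=> l; rewrite mnmBE subnn mnm0E.
    by rewrite mderivZ mderivX mnm1E (negbTE kj) scale0r scaler0.
  rewrite (bigD1 i) //= big1 ?addr0 => [|k ki].
    rewrite mderivX mnm1E eqxx scale1r (_ : U_(i) - U_(i) = 0)%MM ?mpolyX0.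
      by rewrite /lin_subst comp_mpoly1 -mul_mpolyC mulr1.
    by apply/mnmP=> l; rewrite mnmBE subnn mnm0E.
  by rewrite mderivX mnm1E eq_sym (negbTE ki) scale0r /lin_subst comp_mpoly0 scaler0.
- rewrite /lin_subst rmorphD mderivD /= -!/(lin_subst _ _) IHp IHq -big_split.
  by apply: eq_bigr => i _ /=; rewrite mderivD /lin_subst rmorphD scalerDr.
- rewrite /lin_subst rmorphM mderivM /= -!/(lin_subst _ _) IHp IHq mulr_suml mulr_sumr -big_split.
  apply: eq_bigr => i _ /=; rewrite mderivM /lin_subst rmorphD !rmorphM scalerDr.
  by congr (_ + _); [rewrite scalerAl | rewrite scalerAr].
Qed.

End LinearSubstitution.

(** * Forms whose polar matrices are simultaneously diagonalisable *)

Lemma invmx_mul (K : fieldType) n (A B : 'M[K]_n) :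
  A \in unitmx -> B \in unitmx -> invmx (A *m B) = invmx B *m invmx A.
Proof.
move=> uA uB; have uAB : A *m B \in unitmx by rewrite unitmx_mul uA.
by apply: (can_inj (mulKmx uAB)); rewrite mulmxV // -mulmxA mulKVmx // mulmxV.
Qed.

Section Structure.
Variable K : fieldType.
Hypothesis charK : [pchar K] =i pred0.

Let two_neq0 : 2%:R != 0 :> K.
Proof. by rewrite (pcharf0P K).1. Qed.

(* Lagrange reduction of a quadratic form, one rank at a time, inside the blocks
   of equal labels. *)
Lemma sym_block_sum (T : Type) t (lab : 'I_t -> T) r (B : 'M[K]_t) :
    B^T = B -> (forall i j, B i j != 0 -> lab i = lab j) -> (\rank B <= r)%N ->
  exists (c : 'I_r -> K) (l : 'I_r -> 'rV[K]_t),
    (forall k i j, l k 0 i != 0 -> l k 0 j != 0 -> lab i = lab j) /\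
    B = \sum_k c k *: ((l k)^T *m l k).
Proof.
elim: r B => [|r IH] B Bsym Blab Br.
  exists (fun _ => 0), (fun _ => 0); split; first by case.
  by apply/eqP; rewrite big_ord0 -mxrank_eq0 -leqn0.
have [->|/matrix0Pn[i [j Bij]]] := eqVneq B 0.
  exists (fun _ => 0), (fun _ => 0); split; first by move=> k a b; rewrite mxE eqxx.
  by rewrite big1 // => k _; rewrite scale0r.
have bilE (a b : 'I_t) : delta_mx 0 a *m B *m delta_mx b 0 = (B a b)%:M :> 'M[K]_1.
  by apply/matrixP=> x y; rewrite !ord1 -rowE -colE !mxE eqxx.
have Bs a b : B a b = B b a by rewrite -[in LHS]Bsym mxE.
(* A non-isotropic [v] is found among [e_i], [e_j] and [e_i + e_j]; if the first two are isotropic,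
   the third has value [2 * B i j], nonzero in characteristic 0. Each choice keeps the support of
   [B *m v] in the block of [i]. *)
have [v [vlab vBv]] : exists v : 'cV[K]_t,
    (forall k, (B *m v) k 0 != 0 -> lab k = lab i) /\ (v^T *m B *m v) 0 0 != 0.
  have [Bii|Bii] := eqVneq (B i i) 0; last first.
    exists (delta_mx i 0); split; last by rewrite trmx_delta bilE mxE.
    by move=> k; rewrite -colE mxE => /Blab.
  have [Bjj|Bjj] := eqVneq (B j j) 0; last first.
    exists (delta_mx j 0); split; last by rewrite trmx_delta bilE mxE.
    by move=> k; rewrite -colE mxE => /Blab->; rewrite (Blab _ _ Bij).
  exists (delta_mx i 0 + delta_mx j 0); split.
    move=> k; rewrite mulmxDr -!colE !mxE.
    have [->|/Blab-> //] := eqVneq (B k i) 0.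
    by rewrite add0r => /Blab->; rewrite (Blab _ _ Bij).
  rewrite [(_ + _)^T]linearD /= !trmx_delta mulmxDl mulmxDr !mulmxDl !bilE !mxE /= !mulr1n.
  by rewrite Bii Bjj add0r addr0 [B j i]Bs -mulr2n -mulr_natl mulf_neq0.
set beta := (v^T *m B *m v) 0 0 in vBv; pose w := B *m v.
have betaE : v^T *m B *m v = beta%:M by rewrite [LHS]mx11_scalar.
have wT : w^T = v^T *m B by rewrite trmx_mul Bsym.
(* Completing the square: the row space of [B'] lies in that of [B], but [B'] kills [v] and [B] does
   not, so the rank drops. *)
pose B' := B - beta^-1 *: (w *m w^T).
have B'sym : B'^T = B' by rewrite linearB linearZ /= trmx_mul trmxK Bsym.
have B'lab a b : B' a b != 0 -> lab a = lab b.
  have -> : B' a b = B a b - beta^-1 * (w a 0 * w b 0).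
    by rewrite /B'; move: w wT {B'sym}@B' => z _ _; rewrite !mxE big_ord1 mxE.
  have [->|/Blab//] := eqVneq (B a b) 0.
  rewrite add0r oppr_eq0 !mulf_eq0 !negb_or => /and3P[_ wa wb].
  by rewrite (vlab a) // (vlab b).
have B'v : B' *m v = 0.
  rewrite mulmxBl -scalemxAl -mulmxA wT betaE -/w mul_mx_scalar scalerA mulVf //.
  by rewrite scale1r subrr.
have B'r : (\rank B' <= r)%N.
  rewrite -ltnS; apply: leq_trans Br; apply: rank_ltmx; rewrite ltmxE; apply/andP; split.
    apply/submxP; exists (1%:M - beta^-1 *: (w *m v^T)).
    by rewrite mulmxBl mul1mx -scalemxAl -mulmxA -wT.
  apply: contra vBv => /submxP[X BX].
  by rewrite /beta -mulmxA BX -mulmxA B'v !mulmx0 mxE.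
have [c [l [llab lE]]] := IH B' B'sym B'lab B'r.
exists (fun k => oapp c beta^-1 (unlift ord0 k)), (fun k => oapp l w^T (unlift ord0 k)).
split=> [k a b|].
  case: unliftP => [k' _|_] /=; first exact: llab.
  by rewrite ![w^T _ _]mxE => wa wb; rewrite (vlab a) // (vlab b).
rewrite big_ord_recl unlift_none /= trmxK.
under eq_bigr do rewrite liftK /=.
by rewrite -lE /B' addrC subrK.
Qed.

Lemma polar_mx_polymx e n (g : {mpoly K[n]}) : polymx e (polar_mx e g).
Proof.
move=> p q.
exists (\sum_(u : e.-tuple 'I_n) symtensor g [:: p, q & u] *: \prod_(k <- u) 'X_k).
  set f := \sum_u _; have /dhomogP fe : f \is e.-homog.
    by apply: rpred_sum => u _; apply: rpredZ; apply: dhomog_prodX.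
  by rewrite msizeE; apply/bigmax_leqP_seq => m /fe /= -> _.
move=> y; rewrite mxE raddf_sum /=; apply: eq_bigr => u _; rewrite mevalZ rmorph_prod.
by congr (_ * _); apply: eq_bigr => k _; rewrite /= mevalXU.
Qed.

(** The off-diagonal entries are polynomials in [y] whose coefficients are the tensor entries with
    two distinct indices; these therefore vanish. A zero coefficient [c i] would put a zero on the
    diagonal at [y0]. *)
Lemma diag_form_of_polar e n (g : {mpoly K[n]}) y0 :
    g \is e.+2.-homog -> (forall y, is_diag_mx (polar_mx e g y)) ->
    polar_mx e g y0 \in unitmx ->
  exists2 c : 'I_n -> K, (forall i, c i != 0) & g = diag_form e.+2 c.
Proof.
move=> gd gdiag gunit; pose c i := symtensor g (nseq e.+2 i).
have T0 p q (u : e.-tuple 'I_n) : p != q -> symtensor g [:: p, q & u] = 0.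
  move=> pq.
  rewrite (symtensor_uniq charK (g := 0)
    (T := fun u : e.-tuple _ => symtensor g [:: p, q & u])).
  - by rewrite /symtensor mcoeff0 mul0r.
  - by move=> s s' ss'; apply: symtensor_perm; rewrite !perm_cons.
  apply/esym/mpoly_eval_eq0 => // v; rewrite raddf_sum /=.
  rewrite -[RHS](is_diag_mxP (gdiag (\col_k v k)) p q pq) mxE.
  apply: eq_bigr => s _; rewrite mevalZ rmorph_prod; congr (_ * _).
  by apply: eq_bigr => k _; rewrite /= mevalXU mxE.
have gE : g = diag_form e.+2 c.
  apply: (symtensor_inj charK gd (diag_form_homog _ _)) => s.
  rewrite symtensor_diag_form //; under eq_bigr do rewrite prod_tuple_eq size_tuple.
  have [[i sE]|sN] := pselect (exists i, val s = nseq e.+2 i).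
    rewrite (bigD1 i) //= sE eqxx mulr1 big1 ?addr0 // => j ji.
    by rewrite [_ == _](_ : _ = false) ?mulr0 //= eqseq_cons eq_sym (negbTE ji).
  rewrite big1 => [|i _]; last first.
    by case: eqP => [sE|]; rewrite ?mulr0 //; case: sN; exists i.
  (* A non-constant tuple has an entry [q] different from its head [p]; symmetry moves it to second
     place, where [T0] applies. *)
  case/tupleP: s sN => p s sN.
  have /allPn[q qs qp] : ~~ all (pred1 p) s.
    apply/negP => /all_pred1P sE; apply: sN; exists p.
    by rewrite /= sE size_tuple.
  have := perm_to_rem qs => sq.
  have sz : size (rem q s) == e by rewrite size_rem // size_tuple.
  have ps : perm_eq (p :: s) [:: p, q & Tuple sz] by rewrite perm_cons.
  by rewrite (symtensor_perm g ps) T0 // eq_sym.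
exists c => // i; apply: contraTneq gunit => ci0; rewrite unitmxE unitfE.
rewrite gE polar_mx_diag_form // det_diag (bigD1 i) //= mxE ci0 !mul0r eqxx //.
Qed.

(** The basis given by [Q] diagonalises every [H(y0)^-1 H(y)] but makes [H(y0)] only block diagonal.
    Lagrange reduction [L] inside the blocks completes the work, and the rows of [L *m Q] are the
    linear forms sought. *)
Lemma sum_of_powers_codiag e t (g : {mpoly K[t]}) y0 (Q : 'M[K]_t) :
    g \is e.+2.-homog -> polar_mx e g y0 \in unitmx -> Q \in unitmx ->
    (forall y, is_diag_mx (Q *m (invmx (polar_mx e g y0) *m polar_mx e g y) *m invmx Q)) ->
  sum_of_powers e.+2 t g.
Proof.
move=> gd; set H0 := polar_mx e g y0 => uH0 uQ.
pose Lam y := Q *m (invmx H0 *m polar_mx e g y) *m invmx Q.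
move=> Ldiag; have {}Ldiag y : is_diag_mx (Lam y) := Ldiag y.
pose B := (invmx Q)^T *m H0 *m invmx Q.
have uB : B \in unitmx by rewrite !unitmx_mul unitmx_tr unitmx_inv uQ uH0.
have Bsym : B^T = B by rewrite !trmx_mul trmxK polar_mx_sym mulmxA.
have BLam y : B *m Lam y = (invmx Q)^T *m polar_mx e g y *m invmx Q.
  rewrite /B /Lam -!mulmxA; congr (_ *m _).
  by rewrite (mulKmx uQ) (mulKVmx uH0).
have LamE y i j : (B *m Lam y) i j = B i j * Lam y j j.
  rewrite mxE (bigD1 j) //= big1 ?addr0 // => k kj.
  by rewrite (is_diag_mxP (Ldiag y)) ?mulr0.
(* [B *m Lam y] is symmetric with entries [B i j * Lam y j j], so a nonzero [B i j] forces equal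
   eigenvalues at every [y]. The label of an index is its eigenvalue as a function of [y], and
   blocks are joint eigenspaces. *)
have Blab i j : B i j != 0 -> (fun y => Lam y i i) = (fun y => Lam y j j).
  move=> Bij; apply/funext => y; apply: (mulfI Bij); rewrite -LamE.
  have <- : (B *m Lam y)^T = B *m Lam y.
    by rewrite BLam !trmx_mul trmxK polar_mx_sym mulmxA.
  by rewrite [RHS]mxE LamE -{1}Bsym [B^T i j]mxE.
have [c [l [llab lE]]] := sym_block_sum Bsym Blab (rank_leq_row B).
pose L := \matrix_k l k; pose C := diag_mx (\row_k c k).
have BE : B = L^T *m C *m L.
  apply/matrixP=> i j; rewrite lE summxE mxE; apply: eq_bigr => k _.
  rewrite !mxE big_ord1 (bigD1 k) //= big1 ?addr0 => [|k' kk'].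
    by rewrite !mxE eqxx mulr1n mulrA [c k * _]mulrC.
  by rewrite !mxE (negbTE kk') mulr0.
(* The reduction was asked for exactly [t] terms, so [L] is square and inherits invertibility from
   [B]. *)
have uL : L \in unitmx by move: uB; rewrite BE unitmx_mul => /andP[].
pose N := L *m Q.
have uN : N \in unitmx by rewrite unitmx_mul uL.
have LLam y : is_diag_mx (L *m Lam y *m invmx L).
  (* Row [k] of [L] is supported in one block, so it is a joint left eigenvector with the eigenvalue
     read off at any index of its support; for a zero row any default would do. *)
  pose M := diag_mx (\row_k if [pick j | l k 0 j != 0] is Some j then Lam y j j else 0).
  suff -> : L *m Lam y = M *m L by rewrite mulmxK //; apply: diag_mx_is_diag.
  apply/matrixP=> k j; rewrite mul_diag_mx !mxE (bigD1 j) //= big1 ?addr0 => [|i ij]; last first.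
    by rewrite (is_diag_mxP (Ldiag y)) ?mulr0.
  rewrite !mxE mulrC; have [->|lkj] := eqVneq (l k 0 j) 0; first by rewrite !mulr0.
  case: pickP => [i lki|/(_ j)]; last by rewrite lkj.
  have /= Lij := congr1 (fun f => f y) (llab k i j lki lkj).
  by rewrite Lij [Lam y j j]mxE.
pose g2 := lin_subst (invmx N) g.
have g2d : g2 \is e.+2.-homog by apply: lin_subst_homog.
have g2E : g = lin_subst N g2 by rewrite lin_substM mulVmx // lin_subst1.
have invN : invmx N = invmx Q *m invmx L by rewrite invmx_mul.
(* In the new coordinates [L^T] cancels and a product of two diagonal matrices remains. *)
have pol2 y : polar_mx e g2 y = C *m (L *m Lam (invmx N *m y) *m invmx L).
  rewrite polar_mx_lin_subst //; set z := invmx N *m y; rewrite invN trmx_mul.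
  have -> : (invmx L)^T *m (invmx Q)^T *m polar_mx e g z *m (invmx Q *m invmx L)
      = (invmx L)^T *m (B *m Lam z) *m invmx L by rewrite BLam !mulmxA.
  by rewrite BE !mulmxA -trmx_mul mulmxV // trmx1 mul1mx.
have [c2 c2N0 g2c] : exists2 c : 'I_t -> K, (forall i, c i != 0) & g2 = diag_form e.+2 c.
  apply: (diag_form_of_polar (y0 := N *m y0) g2d).
    move=> y; rewrite pol2; apply/is_diag_mxP => i j ij; rewrite mul_diag_mx mxE.
    by rewrite (is_diag_mxP (LLam _)) ?mulr0.
  by rewrite polar_mx_lin_subst // mulKmx // !unitmx_mul unitmx_tr unitmx_inv uN uH0.
exists c2, N; split; [exact: c2N0 | by rewrite row_free_unit |].
by rewrite -lin_subst_diag_form -g2c -g2E.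
Qed.

End Structure.

(** * The test on a form *)

Section FormTest.
Variable K : fieldType.

Lemma diagonalizableE n (A : 'M[K]_n) :
  diagonalizable A <-> exists2 Q, Q \in unitmx & is_diag_mx (Q *m A *m invmx Q).
Proof. by split=> -[Q uQ dQ]; exists Q; rewrite // /similar_to conjumx in dQ *. Qed.

(** A congruence by [R] conjugates each [invmx T1 *m T] by [R], which preserves commutation and
    diagonalisability; a singular [R] makes the first matrix singular. *)
Lemma slices_test_congr n (R T1 T2 T3 : 'M[K]_n) :
  slices_test (R^T *m T1 *m R) (R^T *m T2 *m R) (R^T *m T3 *m R)
    = (R \in unitmx) && slices_test T1 T2 T3.
Proof.
rewrite /slices_test !unitmx_mul unitmx_tr.
have [uR|_] := boolP (R \in unitmx); last by rewrite !andbF.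
have [uT|_] := boolP (T1 \in unitmx); last by rewrite andbF.
rewrite !andTb.
have E T : invmx (R^T *m T1 *m R) *m (R^T *m T *m R) = invmx R *m (invmx T1 *m T) *m R.
  rewrite !invmx_mul ?unitmx_mul ?unitmx_tr ?uR // -!mulmxA; do 2!congr (_ *m _).
  by rewrite mulKmx ?unitmx_tr.
have conjM X Y : invmx R *m X *m R *m (invmx R *m Y *m R) = invmx R *m (X *m Y) *m R.
  by rewrite -!mulmxA mulKVmx.
rewrite !E; congr (_ && _).
  rewrite /comm_mxb !conjM; apply/eqP/eqP => [|->//].
  by move/(can_inj (mulmxK uR))/(can_inj (mulKVmx uR)).
apply/asboolP/asboolP => /diagonalizableE[Q uQ dQ]; apply/diagonalizableE.
  exists (Q *m invmx R); first by rewrite unitmx_mul uQ unitmx_inv.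
  by rewrite invmx_mul ?unitmx_inv // invmxK !mulmxA in dQ *.
exists (Q *m R); first by rewrite unitmx_mul uQ.
by rewrite invmx_mul // !mulmxA mulmxK // -!mulmxA mulKVmx ?mulmxA // in dQ *.
Qed.

Hypothesis charK : [pchar K] =i pred0.

(** After truncation the congruence is by the first [t] columns of [R] only, while the polar
    matrices are taken at its first three columns, even when [t < 3]. *)
Lemma form_test_polar e t (g : {mpoly K[t]}) (R : 'M[K]_(t, maxn t 3)) :
  g \is e.+2.-homog ->
  form_test e.+2 g R =
    (colsub (widen_ord (leq_maxl t 3)) R \in unitmx) &&
    slices_test (polar_mx e g (col (widen_ord (leq_maxr t 3) 0) R))
                (polar_mx e g (col (widen_ord (leq_maxr t 3) 1) R))
                (polar_mx e g (col (widen_ord (leq_maxr t 3) 2) R)).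
Proof.
move=> gd; rewrite -slices_test_congr /form_test.
have subE (X : 'M[K]_t) (w : 'I_t -> 'I_(maxn t 3)) :
    mxsub w w (R^T *m X *m R) = (colsub w R)^T *m X *m colsub w R.
  apply/matrixP=> i j; rewrite !mxE; apply: eq_bigr => k _; rewrite !mxE.
  by congr (_ * _); apply: eq_bigr => l _; rewrite !mxE.
have sliceE k (w : 'I_t -> 'I_(maxn t 3)) : mxsub w w (slice_bar e.+2 (lin_subst R g) k)
    = (colsub w R)^T *m polar_mx e g (col k R) *m colsub w R.
  by rewrite (slice_bar_lin_subst charK _ _ gd) subE.
by rewrite !sliceE.
Qed.

Variable S : {fset K}.

Lemma mean_slices_test_le e t (g : {mpoly K[t]}) (y0 : 'cV[K]_t) :
  g \is e.+2.-homog -> ~ sum_of_powers e.+2 t g ->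
  mean (fun y : 'cV[S]_t => mean (fun z : 'cV[S]_t =>
      (slices_test (polar_mx e g y0) (polar_mx e g (map_mx val y))
                   (polar_mx e g (map_mx val z)))%:R))
    <= (2 * e)%:R / #|` S|%:R.
Proof.
move=> gd gN; pose eps : rat := e%:R / #|` S|%:R.
have eps0 : 0 <= eps by rewrite divr_ge0.
have -> : (2 * e)%:R / #|` S|%:R = eps + eps by rewrite -mulrDl -natrD mul2n addnn.
have [uH|uH] := boolP (polar_mx e g y0 \in unitmx); last first.
  rewrite /slices_test (negbTE uH) /=.
  by do 2!(apply: mean_le_cst => [|?]; rewrite ?addr_ge0 //).
pose A y := invmx (polar_mx e g y0) *m polar_mx e g y.
have pA : polymx e A by apply/polymx_mull/polar_mx_polymx.
pose dg (y : 'cV[S]_t) := `[< diagonalizable (A (map_mx val y)) >].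
apply: le_trans (_ : mean (fun y : 'cV[S]_t => mean (fun z : 'cV[S]_t =>
    (comm_mxb (A (map_mx val y)) (A (map_mx val z)) && dg y)%:R)) <= _).
  by apply: le_mean => y; apply: le_mean => z; rewrite /slices_test uH.
have [com|] := pselect (forall y z, A y *m A z = A z *m A y); last first.
  case/existsNP=> y1 /existsNP[z1 /eqP yz1].
  pose comm y z := A y *m A z - A z *m A y.
  have pcomm1 z : polymx e (fun y => comm y z).
    by apply: polymxB; [apply: polymx_mulr | apply: polymx_mull].
  have pcomm2 y : polymx e (comm y).
    by apply: polymxB; [apply: polymx_mull | apply: polymx_mulr].
  (* One [eps] covers the [y] whose commutator with [z1] vanishes; for any other [y] the commutator
     is a nonzero polynomial map of [z], which costs the second [eps]. *)
  apply: le_trans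
    (_ : mean (fun y : 'cV[S]_t => (comm (map_mx val y) z1 == 0)%:R + eps) <= _); last first.
    rewrite meanD; apply: lerD; last exact: mean_le_cst.
    by apply: (mean_polymx0 S (pcomm1 z1)); exists y1; rewrite subr_eq0.
  apply: le_mean => y; have [y0E|y0N] := eqVneq (comm _ z1) 0.
    apply: le_trans (_ : 1 <= _); last by rewrite lerDl.
    by apply: mean_le_cst => // z; rewrite lern1 leq_b1.
  rewrite add0r; apply: le_trans (mean_polymx0 S (pcomm2 (map_mx val y)) _); last by exists z1.
  apply: le_mean => z; rewrite ler_nat.
  by rewrite subr_eq0 -/(comm_mxb _ _); case: (comm_mxb _ _); rewrite // leq_b1.
apply: le_trans (_ : eps <= _); last by rewrite lerDl.
apply: le_trans (_ : mean (fun y : 'cV[S]_t => (dg y)%:R) <= _).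
  apply: le_mean => y; apply: mean_le_cst => [|z]; first by case: (dg y).
  by rewrite ler_nat; case: (dg y); rewrite ?andbT ?andbF ?leq_b1.
(* The family is indexed by the finitely many sample points that pass [dg]; its members commute and
   are diagonalisable, so one [Q] serves them all. *)
have [|Q uQ /allP Qd] := (codiagonalizableP [seq A (map_mx val y) | y : 'cV[S]_t in dg]).1.
  split=> [X Y /mapP[y _ ->] /mapP[z _ ->]|X /mapP[y]]; first exact: com.
  by rewrite mem_enum => /asboolP dy ->.
pose F y := Q *m A y *m invmx Q.
have pF : polymx e F by apply/polymx_mulr/polymx_mull.
have [Fd|/existsNP[y /negP/is_diag_mxP nd]] := pselect (forall y, is_diag_mx (F y)).
  by case: gN; apply: sum_of_powers_codiag gd uH uQ Fd.
have [i [j [ij Fij]]] : exists i j, i != j /\ F y i j != 0.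
  apply: contrapT => nF; apply: nd => i j ij; apply/eqP/negPn/negP => Fij.
  by apply: nF; exists i, j.
apply: le_trans (mean_polyfun0 S (pF i j) _); last by exists y.
apply: le_mean => z; have [dz|//] := boolP (dg z); rewrite ler_nat.
have /Qd : A (map_mx val z) \in [seq A (map_mx val y) | y : 'cV[S]_t in dg].
  by apply/mapP; exists z; rewrite // mem_enum.
rewrite /= /similar_to conjumx // => /is_diag_mxP/(_ i j ij)/eqP.
by rewrite -/(F _) => ->.
Qed.

(** The columns of index 1 and 2 are resampled with the others held fixed; column 0 plays the part
    of [y0]. *)
Lemma mean_form_test_le e t (g : {mpoly K[t]}) :
  g \is e.+2.-homog -> ~ sum_of_powers e.+2 t g ->
  mean (fun R : 'M[S]_(t, maxn t 3) => (form_test e.+2 g (map_mx val R))%:R)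
    <= (2 * e)%:R / #|` S|%:R.
Proof.
move=> gd gN; pose k := widen_ord (leq_maxr t 3).
have c0 : 0 <= (2 * e)%:R / #|` S|%:R :> rat by rewrite divr_ge0.
rewrite (mean_resample (get := col (k 2)) (upd := set_col (k 2))); last 2 first.
- exact: col_set_col.
- exact: set_col_col.
apply: (mean_resample_le (get := col (k 1)) (upd := set_col (k 1))) => //.
- exact: col_set_col.
- exact: set_col_col.
move=> a; apply: le_trans (mean_slices_test_le (map_mx val (col (k 0) a)) gd gN).
apply: le_mean => y; apply: le_mean => z; rewrite ler_nat form_test_polar //.
rewrite -/k -!map_col col_set_col 2?[col _ (set_col (k 2) _ _)]col_set_col_neq //.
rewrite [col _ (set_col (k 1) a y)]col_set_col_neq // col_set_col.
by case: (_ \in unitmx).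
Qed.

End FormTest.

(** * Acceptance of sums of powers *)

Section AcceptProbability.
Variables (K : fieldType) (S : {fset K}).
Hypothesis charK : [pchar K] =i pred0.

(** The chosen columns are independent random vectors, and a proper subspace contains one with
    probability at most [1 / |S|], since a nonzero linear form vanishes on it. *)
Lemma mean_colsub_unit t m (w : 'I_t -> 'I_m) : injective w ->
  mean (fun R : 'M[S]_(t, m) => (colsub w (map_mx val R) \notin unitmx)%:R)
    <= t%:R / #|` S|%:R.
Proof.
move=> winj; have eps0 : 0 <= 1%:R / #|` S|%:R :> rat by rewrite divr_ge0.
pose phi (x : 'cV[S]_t) : 'rV[K]_t := (map_mx val x)^T.
have := @mean_rank_deficient K _ _ t t t (fun i => col (w i))
  (fun i => @set_col S t m (w i)) _ _ _ phi 1%:M _ eps0.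
rewrite mxrank1 mulrA mulr1 => H; apply: le_trans (H _ _ _ _ _ _) => //.
- apply: le_mean => R; rewrite ler_nat; set X := \matrix_i _.
  suff -> : colsub w (map_mx val R) = X^T.
    by rewrite unitmx_tr -row_free_unit.
  by apply/matrixP=> i j; rewrite !mxE.
- by move=> i a x; apply: col_set_col.
- by move=> i j a x ji; apply: col_set_col_neq; rewrite inj_eq.
- by move=> i a x; apply: set_col_col.
- by move=> x; apply: submx1.
move=> U /submx_separate[v Uv]; rewrite mul1mx => v0.
have pv : polymx 1 (fun y : 'cV[K]_t => v^T *m y) by apply: polymx_mull; apply: polymx_id.
apply: le_trans (mean_polymx0 S pv _); last first.
  have /matrix0Pn[i [j vij]] := v0; exists (delta_mx i 0).
  by apply/matrix0Pn; exists j, 0; rewrite -colE !mxE.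
apply: le_mean => x; rewrite ler_nat; have [/submxP[X xE]|//] := boolP (phi x <= U)%MS.
by rewrite -[_ *m _]trmxK trmx_mul trmxK -/(phi x) xE -mulmxA Uv mulmx0 trmx0 eqxx.
Qed.

Lemma slices_test_diag n (x y z : 'rV[K]_n) :
  (forall i, x 0 i != 0) -> slices_test (diag_mx x) (diag_mx y) (diag_mx z).
Proof.
move=> x0; pose x' : 'rV[K]_n := \row_i (x 0 i)^-1.
have ux : diag_mx x \in unitmx.
  by rewrite unitmxE unitfE det_diag; apply/prodf_neq0 => i _.
have xx' : diag_mx x *m diag_mx x' = 1%:M.
  by apply/matrixP=> i j; rewrite mulmx_diag !mxE mulfV.
have x'E : invmx (diag_mx x) = diag_mx x' by rewrite -[LHS]mulmx1 -xx' mulKmx.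
rewrite /slices_test ux x'E !mulmx_diag /comm_mxb diag_mxC eqxx.
by apply/asboolP; apply: diagonalizable_diag.
Qed.

(** Union bound: [t / |S|] for singular first [t] columns of [R], and [e / |S|] for each of the [t]
    diagonal entries of the first polar matrix, which sum to [t * e.+1 / |S|]. *)
Lemma mean_form_test_ge e t (g : {mpoly K[t]}) : (0 < #|` S|)%N ->
  sum_of_powers e.+2 t g ->
  1 - (t * e.+1)%:R / #|` S|%:R <=
  mean (fun R : 'M[S]_(t, maxn t 3) => (form_test e.+2 g (map_mx val R))%:R).
Proof.
move=> S0 [c [L [c0 Lfree gE]]]; have uL : L \in unitmx by rewrite -row_free_unit.
have {}gE : g = lin_subst L (diag_form e.+2 c) by rewrite lin_subst_diag_form.
have dd := diag_form_homog e.+2 c.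
have gd : g \is e.+2.-homog by rewrite gE; apply: lin_subst_homog.
pose w := widen_ord (leq_maxl t 3); pose k0 := widen_ord (leq_maxr t 3) 0.
pose bad1 (R : 'M[S]_(t, maxn t 3)) := colsub w (map_mx val R) \notin unitmx.
pose bad2 i (R : 'M[S]_(t, maxn t 3)) := (L *m map_mx val (col k0 R)) i 0 ^+ e == 0.
have eps0 : 0 <= e%:R / #|` S|%:R :> rat by rewrite divr_ge0.
(* Up to congruence the test sees diagonal matrices with entries [c i * (L *m r) i 0 ^+ e], [r] a
   column of [R]; it then suffices that the first one is invertible. *)
have okP R : ~~ bad1 R -> (forall i, ~~ bad2 i R) -> form_test e.+2 g (map_mx val R).
  rewrite negbK => uR nb; rewrite form_test_polar // uR andTb.
  rewrite gE !polar_mx_lin_subst // slices_test_congr uL andTb !polar_mx_diag_form //.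
  apply: slices_test_diag => i; rewrite mxE mulf_neq0 //.
  by have := nb i; rewrite /bad2 map_col.
rewrite lerBlDr -lerBlDl -(mean_negb _ (card_mx_gt0 _ _ S0)).
apply: le_trans (_ : mean (fun R => (bad1 R)%:R + \sum_i (bad2 i R)%:R) <= _).
  apply: le_mean => R; have [b1|nb1] := boolP (bad1 R).
    by apply: le_trans (_ : 1 <= _); [rewrite lern1 leq_b1 | rewrite lerDl sumr_ge0].
  have [/existsP[i b2]|/existsPn nb2] := boolP [exists i, bad2 i R].
    rewrite add0r (bigD1 i) //= b2; apply: le_trans (_ : 1 <= _).
      by rewrite lern1 leq_b1.
    by rewrite lerDl sumr_ge0.
  by rewrite (okP R nb1 nb2) addr_ge0 ?sumr_ge0.
rewrite meanD mean_sum mulnS natrD mulrDl lerD //.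
  by apply: mean_colsub_unit => i j /(congr1 val) /= ij; apply: val_inj.
rewrite natrM -mulrA mulr_natl -[t in leRHS]card_ord -sumr_const ler_sum // => i _.
apply: (mean_resample_le (get := col k0) (upd := set_col k0)) => // [a x|a x|a].
- exact: col_set_col.
- exact: set_col_col.
rewrite /bad2; under eq_mean do rewrite col_set_col.
(* A zeroth power is the constant 1 and never vanishes; a positive power vanishes with the linear
   form, whose bound [1 / |S|] is at most the one claimed. *)
case: e eps0 {gE gd okP bad2 dd} => [|e] eps0.
  by apply: mean_le_cst => // x; rewrite expr0 oner_eq0.
apply: le_trans (_ : 1%:R / #|` S|%:R <= _); last by rewrite ler_wpM2r ?invr_ge0 // ler_nat.
have pv : polymx 1 (fun y : 'cV[K]_t => L *m y) by apply: polymx_mull; apply: polymx_id.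
apply: le_trans (mean_polyfun0 S (pv i 0) _).
  by apply: le_mean => x; rewrite expf_eq0.
by exists (col i (invmx L)); rewrite colE mulKVmx // mxE !eqxx oner_eq0.
Qed.

End AcceptProbability.

(** * Essential variables *)

Section Gradient.
Variables (K : fieldType) (n : nat).
Implicit Types (P : {mpoly K[n]}) (v : 'cV[K]_n).

Definition dderiv P v : {mpoly K[n]} := \sum_j v j 0 *: P^`M(j).

Lemma msize_dderiv P v D : (msize P <= D.+2)%N -> (msize (dderiv P v) <= D.+1)%N.
Proof.
move=> PD; rewrite (leq_trans (msize_sum _ _ _)) //; apply/bigmax_leqP_seq => j _ _.
rewrite (leq_trans (msizeZ_le _ _)) // msizeE; apply/bigmax_leqP_seq => m mP _.
have : (m + U_(j))%MM \in msupp P.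
  move: mP; rewrite !mcoeff_msupp mcoeff_mderiv; apply: contra_neq => ->.
  by rewrite mul0rn.
by move/msize_mdeg_lt/leq_trans/(_ PD); rewrite mdegD mdeg1 addn1.
Qed.

Lemma msize_homog P d : P \is d.-homog -> (msize P <= d.+1)%N.
Proof. by move/dhomogP=> Pd; rewrite msizeE; apply/bigmax_leqP_seq => m /Pd /= -> _. Qed.

Lemma gradient_mul P (a : 'M[K]_n) v i :
  (gradient_mx P a *m v) i 0 = (dderiv P v).@[fun k => a i k].
Proof.
rewrite mxE raddf_sum; apply: eq_bigr => j _.
by rewrite /= mevalZ mxE mulrC.
Qed.

(** A matrix describing the directions of zero derivative, so that its row space and rank can be
    compared with those of the gradient matrix. *)
Definition dderiv_kernel P N (W : 'M[K]_(N, n)) : Prop :=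
  forall v, W *m v = 0 <-> dderiv P v = 0.

(** The columns of [W] list the coefficients of the partial derivatives. *)
Lemma dderiv_kernel_exists P : exists N (W : 'M[K]_(N, n)), dderiv_kernel P W.
Proof.
pose D := msize P; pose I := {: 'X_{1..n < D.+1}}.
pose W : 'M[K]_(#|I|, n) := \matrix_(mu, j) (P^`M(j))@_(enum_val mu : 'X_{1..n < D.+1}).
exists #|I|, W => v.
have WE mu : (W *m v) mu 0 = (dderiv P v)@_(enum_val mu : 'X_{1..n < D.+1}).
  rewrite mxE raddf_sum; apply: eq_bigr => j _.
  by rewrite /= mcoeffZ mxE mulrC.
split=> [W0|D0]; last by apply/colP=> mu; rewrite WE D0 mcoeff0 mxE.
apply/mpolyP=> m; rewrite mcoeff0; have [mD|mD] := ltnP (mdeg m) D.+1.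
  have := WE (enum_rank (BMultinom mD)); rewrite W0 mxE enum_rankK /= => <- //.
apply: memN_msupp_eq0; apply: msize_mdeg_ge; apply: leq_trans mD.
by apply: msize_dderiv; rewrite ltnW.
Qed.

Lemma sub_kernel m1 m2 (A : 'M[K]_(m1, n)) (B : 'M[K]_(m2, n)) :
  (forall v : 'cV_n, A *m v = 0 -> B *m v = 0) -> (B <= A)%MS.
Proof.
move=> AB; apply: contrapT => /negP/submx_separate[v /AB Bv].
by rewrite Bv eqxx.
Qed.

Lemma gradient_sub P N (W : 'M[K]_(N, n)) (a : 'M[K]_n) :
  dderiv_kernel P W -> (gradient_mx P a <= W)%MS.
Proof.
move=> WP; apply: sub_kernel => v /WP Pv; apply/colP=> i.
by rewrite gradient_mul Pv meval0 mxE.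
Qed.

(** Equal ranks turn the inclusion [gradient_sub] of row spaces into an equality, hence the kernels
    agree. *)
Lemma gradient_kernel P N (W : 'M[K]_(N, n)) (a : 'M[K]_n) v :
  dderiv_kernel P W -> \rank (gradient_mx P a) = \rank W ->
  gradient_mx P a *m v = 0 -> dderiv P v = 0.
Proof.
move=> WP rk av; apply/WP.
have [_ eqr] := mxrank_leqif_sup (gradient_sub a WP).
move: eqr; rewrite rk eqxx => /esym/submxP[X ->].
by rewrite -mulmxA av mulmx0.
Qed.

(** The gradients are random rows in the row space of [W]. If [U] does not contain [W], some [v] is
    killed by [U] but not by [W]; a gradient in [U] is then a zero of the nonzero polynomial
    [dderiv P v], of degree at most [e.+1]. *)
Lemma mean_gradient_rank (S : {fset K}) P e N (W : 'M[K]_(N, n)) :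
  P \is e.+2.-homog -> dderiv_kernel P W ->
  mean (fun a : 'M[S]_n => (\rank (gradient_mx P (map_mx val a)) != \rank W)%:R)
    <= (\rank W * e.+1)%:R / #|` S|%:R.
Proof.
move=> Pd WP; have eps0 : 0 <= e.+1%:R / #|` S|%:R :> rat by rewrite divr_ge0.
pose phi (x : 'rV[S]_n) : 'rV[K]_n := \row_j (P^`M(j)).@[fun k => val (x 0 k)].
have phiE (a : 'M[S]_n) : \matrix_i phi (row i a) = gradient_mx P (map_mx val a).
  by apply/matrixP=> i j; rewrite !mxE; apply: meval_eq => k; rewrite !mxE.
have phi_mul x v : (phi x *m v) 0 0 = (dderiv P v).@[fun k => val (x 0 k)].
  by rewrite mxE raddf_sum; apply: eq_bigr => j _; rewrite /= mevalZ mxE mulrC.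
have := @mean_rank_deficient K _ _ n n N (fun i => row i)
  (fun i => @set_row S n n i) _ _ _ phi W _ eps0.
rewrite mulrA -natrM => H; apply: le_trans (H _ _ _ _ _ _).
- by apply: le_mean => a; rewrite phiE.
- by move=> i a x; apply: row_set_row.
- by move=> i j a x ji; apply: row_set_row_neq.
- by move=> i a x; apply: set_row_row.
- move=> x; apply: sub_kernel => v /WP Pv; apply/colP=> i.
  by rewrite ord1 phi_mul Pv meval0 mxE.
- move=> U /submx_separate[v Uv Wv].
  have Pv : dderiv P v != 0 by apply: contra_neq Wv => /WP.
  apply: le_trans (schwartz_zippel S Pv (msize_dderiv v (msize_homog Pd))).
  apply: le_mean => x; rewrite ler_nat -phi_mul.
  have [/submxP[X ->]|//] := boolP (phi x <= U)%MS.
  by rewrite -mulmxA Uv mulmx0 mxE eqxx.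
exact: rank_leq_col.
Qed.

End Gradient.

(** * Passing to the restricted form and back *)

Section EssentialVariables.
Variable K : fieldType.
Hypothesis charK : [pchar K] =i pred0.

(** The inclusion of coordinates for [t <= n]; times its transpose it is the projection on the first
    [t] coordinates. *)
Definition first_vars n t : 'M[K]_(n, t) := \matrix_(i, j) (val i == val j)%:R.

Lemma restrict_varsE n t (f : {mpoly K[n]}) :
  restrict_vars t f = lin_subst (first_vars n t) f.
Proof.
congr (_ \mPo _); apply: eq_from_tnth => i; rewrite !tnth_mktuple /linform.
case: insubP => [j _ ji|it].
  rewrite (bigD1 j) //= !mxE ji eqxx scale1r big1 ?addr0 // => k kj.
  rewrite !mxE -ji (negbTE (_ : val j != val k)) ?scale0r //.
  by apply: contra_neq kj => /val_inj.
rewrite big1 // => j _; rewrite !mxE (negbTE (_ : val i != val j)) ?scale0r //.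
by apply: contraNneq it => ->; apply: ltn_ord.
Qed.

Lemma first_vars_mul n t m (B : 'M[K]_(m, n)) :
  B *m first_vars n t *m (first_vars n t)^T
    = \matrix_(i, j) if (val j < t)%N then B i j else 0.
Proof.
apply/matrixP=> i j; rewrite !mxE.
have BE k : (B *m first_vars n t) i k = \sum_(l | val l == val k) B i l.
  rewrite mxE [RHS]big_mkcond; apply: eq_bigr => l _.
  by rewrite mxE; case: eqP; rewrite ?mulr1 ?mulr0.
case: ifP => jt.
  rewrite (bigD1 (Ordinal jt)) //= big1 ?addr0.
    rewrite BE !mxE /= eqxx mulr1 (bigD1 j) //= big1 ?addr0 // => l /andP[/eqP lj].
    by case/eqP; apply: val_inj.
  move=> k kj; rewrite !mxE (negbTE (_ : val j != val k)) ?mulr0 //.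
  by apply: contra_neq kj => jk; apply: val_inj.
apply: big1 => k _; rewrite !mxE (negbTE (_ : val j != val k)) ?mulr0 //.
by apply: contraFneq jt => ->; apply: ltn_ord.
Qed.

(** In characteristic 0 a variable with zero partial derivative does not occur, so setting it to 0
    changes nothing. *)
Lemma lin_subst_first_vars n t (f : {mpoly K[n]}) :
  (forall j : 'I_n, (t <= j)%N -> f^`M(j) = 0) ->
  lin_subst (first_vars n t *m (first_vars n t)^T) f = f.
Proof.
move=> f0; have fE m (j : 'I_n) : m \in msupp f -> (t <= j)%N -> m j = 0%N.
  move=> mf tj; apply/eqP; apply: contraTT mf => mj; rewrite -mcoeff_eq0.
  have /mpolyP/(_ (m - U_(j))%MM) := f0 j tj.
  rewrite mcoeff0 mcoeff_mderiv submK ?lep1mP //.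
  rewrite -mulr_natr => /eqP; rewrite mulf_eq0 (pcharf0P K).1 // orbF.
  exact.
rewrite [in RHS](mpolyE f) /lin_subst comp_mpolyE big_seq [RHS]big_seq.
apply: eq_bigr => m mf; congr (_ *: _); rewrite mpolyXE_id; apply: eq_bigr => i _.
rewrite tnth_mktuple; have [it|it] := ltnP i t; last by rewrite fE.
congr (_ ^+ _); have := first_vars_mul t (1%:M : 'M[K]_n); rewrite mul1mx => ->.
rewrite /linform (bigD1 i) //=.
rewrite !mxE it eqxx scale1r big1 ?addr0 // => j ji.
by rewrite !mxE eq_sym (negbTE ji) if_same scale0r.
Qed.

Section Reduction.
Variables (n : nat) (P : {mpoly K[n]}) (M A : 'M[K]_n).
Hypothesis MA : kernel_adapted M A.
Hypothesis Mker : forall v : 'cV[K]_n, M *m v = 0 -> dderiv P v = 0.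

Let t := \rank M.
Let g := restrict_vars t (lin_subst A P).
Let J := first_vars n t.

Lemma dderiv_kernel_col (j : 'I_n) : (t <= j)%N -> dderiv P (col j A) = 0.
Proof.
move=> tj; apply: Mker; apply/MA.2; exists (fun k => (k == j)%:R).
rewrite (bigD1 j) //= eqxx scale1r big1 ?addr0 // => k /andP[_ /negbTE->].
by rewrite scale0r.
Qed.

Lemma reduced_formE : g = lin_subst (A *m J) P.
Proof. by rewrite /g restrict_varsE lin_substM. Qed.

(** [P(Ax)] has zero derivative along the kernel columns of [A], so it is recovered from its
    restriction; undoing [A] gives back [P]. *)
Lemma reduced_formK : P = lin_subst (J^T *m invmx A) g.
Proof.
rewrite /g restrict_varsE lin_substM mulmxA -lin_substM lin_subst_first_vars.
  by rewrite lin_substM mulmxV ?MA.1 // lin_subst1.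
move=> j tj; rewrite mderiv_lin_subst.
suff -> : \sum_i A i j *: P^`M(i) = 0 by rewrite /lin_subst comp_mpoly0.
by rewrite -[RHS](dderiv_kernel_col tj); apply: eq_bigr => i _; rewrite mxE.
Qed.

Lemma sum_of_powers_unreduce d : sum_of_powers d t g -> sum_of_powers d t P.
Proof.
move=> [c [L [c0 Lfree gE]]]; exists c, (L *m (J^T *m invmx A)); split=> //.
  have Jfree : row_free J^T.
    apply/row_freeP; exists J; apply/matrixP=> i j; rewrite !mxE.
    have in_ : (i < n)%N := leq_trans (ltn_ord i) (rank_leq_row M).
    rewrite (bigD1 (Ordinal in_)) //= big1 ?addr0 => [|k ki].
      by rewrite !mxE /= eqxx mul1r.
    by rewrite !mxE (negbTE (_ : val k != val i)) ?mul0r.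
  rewrite /row_free mulmxA mxrankMfree ?row_free_unit ?unitmx_inv ?MA.1 //.
  by rewrite mxrankMfree.
have gE' : g = lin_subst L (diag_form d c) by rewrite lin_subst_diag_form.
by rewrite -lin_subst_diag_form -lin_substM -gE' -reduced_formK.
Qed.

End Reduction.

(** Along [w] the diagonal form has derivative [\sum_i d * c i * w_i * x_i ^ (d - 1)] with
    [d = e.+2], which vanishes only for [w = 0]. A right inverse of [L] makes the substitution by
    [L] injective. *)
Lemma dderiv_kernel_powers e t n (c : 'I_t -> K) (L : 'M[K]_(t, n)) :
    (forall i, c i != 0) -> row_free L ->
  dderiv_kernel (lin_subst L (diag_form e.+2 c)) L.
Proof.
move=> c0 /row_freeP[L' LL'] v; pose q := dderiv (diag_form e.+2 c) (L *m v).
have -> : dderiv (lin_subst L (diag_form e.+2 c)) v = lin_subst L q.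
  rewrite /dderiv; under eq_bigr do rewrite mderiv_lin_subst lin_subst_sum scaler_sumr.
  rewrite exchange_big /q /dderiv lin_subst_sum; apply: eq_bigr => i _ /=.
  rewrite mxE scaler_suml; apply: eq_bigr => j _.
  by rewrite scalerA mulrC.
have -> : (lin_subst L q = 0) <-> q = 0.
  split=> [q0|->]; last by rewrite /lin_subst comp_mpoly0.
  by rewrite -[q]lin_subst1 -LL' -lin_substM q0 /lin_subst comp_mpoly0.
split=> [v0|q0].
  by rewrite /q v0 /dderiv big1 // => i _; rewrite mxE scale0r.
have dE i : (diag_form e.+2 c)^`M(i) = (c i *+ e.+2) *: 'X_i ^+ e.+1.
  rewrite /diag_form raddf_sum (bigD1 i) //= big1 ?addr0 => [|k ki].
    rewrite mderivZ !mpolyXn mderivX mulmnE mnm1E eqxx mul1n scalerA mulr_natr.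
    by congr (_ *: 'X_[_]); apply/mnmP=> j; rewrite mnmBE !mulmnE mnm1E mulnS addKn.
  by rewrite mderivZ mpolyXn mderivX mulmnE mnm1E (negbTE ki) mul0n scale0r scaler0.
(* Evaluation at the [i]-th basis vector isolates the [i]-th coefficient. *)
apply/colP=> i; rewrite [RHS]mxE; have := congr1 (meval (fun k => (k == i)%:R)) q0.
rewrite meval0 raddf_sum (bigD1 i) //= big1 ?addr0 => [|k ki].
  rewrite dE !mevalZ rmorphXn /= mevalXU eqxx expr1n mulr1 => /eqP.
  by rewrite mulf_eq0 -mulr_natr mulf_eq0 (negbTE (c0 i)) (pcharf0P K).1 // !orbF => /eqP.
by rewrite dE !mevalZ rmorphXn /= mevalXU (negbTE ki) expr0n !mulr0.
Qed.

(** By [dderiv_kernel_powers], [L] kills the kernel columns of [A], so truncating [L *m A] to its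
    first [\rank M] columns loses no rank. *)
Lemma sum_of_powers_reduce n e (P : {mpoly K[n]}) (M A : 'M[K]_n) :
    kernel_adapted M A -> (forall v : 'cV[K]_n, M *m v = 0 -> dderiv P v = 0) ->
    sum_of_powers e.+2 (\rank M) P ->
  sum_of_powers e.+2 (\rank M) (restrict_vars (\rank M) (lin_subst A P)).
Proof.
move=> MA Mker [c [L [c0 Lfree PE]]].
have PE' : P = lin_subst L (diag_form e.+2 c) by rewrite lin_subst_diag_form.
exists c, (L *m A *m first_vars n (\rank M)); split=> //; last first.
  by rewrite reduced_formE {1}PE' lin_substM mulmxA lin_subst_diag_form.
have LA : L *m A *m first_vars n (\rank M) *m (first_vars n (\rank M))^T = L *m A.
  rewrite first_vars_mul; apply/matrixP=> i j; rewrite mxE; case: ltnP => // tj.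
  have : L *m col j A = 0.
    apply/(dderiv_kernel_powers e c0 Lfree); rewrite -PE'; exact: (dderiv_kernel_col MA Mker).
  by rewrite colE mulmxA -colE => /colP/(_ i); rewrite !mxE.
rewrite /row_free eqn_leq rank_leq_row /=.
apply: leq_trans (mxrankM_maxl _ (first_vars n (\rank M))^T).
by rewrite LA mxrankMfree ?row_free_unit ?MA.1 // (eqP Lfree).
Qed.

End EssentialVariables.

(** [F] dominates [q] times the indicator of [A]. This combines the two random choices: [A] is the
    event that the gradients reach full rank, [q] the bound for the test on the restricted form. *)
Lemma mean_ge_on (T : finType) (A : pred T) (q : rat) (F : T -> rat) :
    (0 < #|T|)%N -> 0 <= q -> (forall x, 0 <= F x) -> (forall x, A x -> q <= F x) ->
  q * (1 - mean (fun x => (~~ A x)%:R)) <= mean F.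
Proof.
move=> T0 q0 F0 qF; rewrite (mean_negb A T0) opprB addrC subrK -meanZ.
apply: le_mean => x; have [/qF|_] := boolP (A x); first by rewrite mulr1.
by rewrite mulr0.
Qed.

(** * The rejection and acceptance bounds *)

Section Main.
Variables (K : fieldType) (S : {fset K}) (n e : nat) (P : {mpoly K[n]}).
Variable choice_A : 'M[S]_n -> 'M[K]_n.
Hypothesis charK : [pchar K] =i pred0.
Hypothesis S_gt0 : (0 < #|` S|)%N.
Hypothesis P_homog : P \is e.+2.-homog.
Hypothesis adapted : forall a : 'M[S]_n,
  kernel_adapted (gradient_mx P (map_mx val a)) (choice_A a).

Lemma reject_prob_ge :
    (forall t, (t <= n)%N -> ~ sum_of_powers e.+2 t P) -> (2 * e <= #|` S|)%N ->
  (1 - (2 * e)%:R / #|` S|%:R) * (1 - (n * e.+1)%:R / #|` S|%:R)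
    <= answer_prob e.+2 P choice_A false.
Proof.
move=> PN eS; have [N [W WP]] := dderiv_kernel_exists P.
have Sr : 0 < #|` S|%:R :> rat by rewrite ltr0n.
(* The size condition on [S] makes the first factor nonnegative, as conditioning on [A] requires. *)
have q0 : 0 <= 1 - (2 * e)%:R / #|` S|%:R :> rat.
  by rewrite subr_ge0 ler_pdivrMr // mul1r ler_nat.
pose A (a : 'M[S]_n) := \rank (gradient_mx P (map_mx val a)) == \rank W.
apply: le_trans (mean_ge_on (A := A) (card_mx_gt0 _ _ S_gt0) q0 _ _).
- rewrite ler_wpM2l // lerD2l lerN2 (le_trans (mean_gradient_rank S P_homog WP)) //.
  by rewrite ler_wpM2r ?invr_ge0 // ler_nat leq_mul2r rank_leq_col orbT.
- by move=> a; apply: mean_ge0.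
move=> a /eqP rk; have ker v := gradient_kernel (v := v) WP rk.
have gN : ~ sum_of_powers e.+2 (\rank (gradient_mx P (map_mx val a)))
    (restrict_vars (\rank (gradient_mx P (map_mx val a))) (lin_subst (choice_A a) P)).
  by move/(sum_of_powers_unreduce charK (adapted a) ker); apply: PN; apply: rank_leq_row.
have gd : restrict_vars (\rank (gradient_mx P (map_mx val a))) (lin_subst (choice_A a) P)
    \is e.+2.-homog.
  by rewrite restrict_varsE; do 2!apply: (lin_subst_homog charK).
rewrite /algorithm; under eq_mean do rewrite eqbF_neg.
rewrite (mean_negb _ (card_mx_gt0 _ _ S_gt0)) lerD2l lerN2.
exact: mean_form_test_le.
Qed.

Lemma accept_prob_ge t :
    sum_of_powers e.+2 t P -> (t * e.+1 <= #|` S|)%N ->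
  (1 - (t * e.+1)%:R / #|` S|%:R) ^+ 2 <= answer_prob e.+2 P choice_A true.
Proof.
move=> Pt tS; have [c [L [c0 Lfree PE]]] := Pt.
have WP : dderiv_kernel P L.
  by rewrite PE -lin_subst_diag_form; apply: dderiv_kernel_powers.
have Sr : 0 < #|` S|%:R :> rat by rewrite ltr0n.
have q0 : 0 <= 1 - (t * e.+1)%:R / #|` S|%:R :> rat.
  by rewrite subr_ge0 ler_pdivrMr // mul1r ler_nat.
pose A (a : 'M[S]_n) := \rank (gradient_mx P (map_mx val a)) == \rank L.
have := mean_gradient_rank S P_homog WP; rewrite (eqP Lfree) => rkL.
rewrite expr2; apply: le_trans (mean_ge_on (A := A) (card_mx_gt0 _ _ S_gt0) q0 _ _).
- by rewrite ler_wpM2l // lerD2l lerN2 /A (eqP Lfree).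
- by move=> a; apply: mean_ge0.
move=> a /eqP rk; have ker v := gradient_kernel (v := v) WP rk.
(* On this event the number of variables of the restricted form is the number [t] of powers in
   [P]. *)
have rt : \rank (gradient_mx P (map_mx val a)) = t by rewrite rk (eqP Lfree).
rewrite -rt in Pt *; rewrite /algorithm; under eq_mean do rewrite eqb_id.
apply: mean_form_test_ge => //; exact: (sum_of_powers_reduce charK (adapted a) ker Pt).
Qed.

End Main.

Theorem theorem4p6 (R : realType) (K : fieldType)
  (hK : K = R :> fieldType \/ K = R[i] :> fieldType)
  (S : {fset K}) (hS : (0 < #|` S|)%N)
  (n d : nat) (hd : (2 <= d)%N)
  (P : {mpoly K[n]}) (hP : P \is d.-homog)
  (choice_A : 'M[S]_n -> 'M[K]_n)
  (hA : forall a : 'M[S]_n,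
      kernel_adapted (gradient_mx P (map_mx val a)) (choice_A a)) :
  ((forall t : nat, (t <= n)%N -> ~ sum_of_powers d t P) ->
   (2 * (d - 2) <= #|` S|)%N ->
   (1 - (2 * (d - 2))%:R / #|` S|%:R) * (1 - (n * (d - 1))%:R / #|` S|%:R)
     <= answer_prob d P choice_A false)
  /\
  (forall t : nat, sum_of_powers d t P ->
   (t * (d - 1) <= #|` S|)%N ->
   (1 - (t * (d - 1))%:R / #|` S|%:R) ^+ 2 <= answer_prob d P choice_A true).
Proof.
have charK : [pchar K] =i pred0 by case: hK => ->; apply: pchar_num.
case: d hd hP hA => [|[|e]] // _ hP hA; rewrite !subSS !subn0.
split=> [PN eS|t]; first exact: reject_prob_ge.
exact: accept_prob_ge.
Qed.
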